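(* Let $X$ be a noncompact, locally compact, separable metrizable space, and let $\operatorname{TBM}(X)$ be the set of all totally bounded metrics on $X$ compatible with its topology. Then for each $n\in\mathbb N$, $$\beta X\approx\sup\{u_\rho X : \dim(u_\rho X\setminus X)=\operatorname{ind}(u_\rho X\setminus X)=\operatorname{Ind}(u_\rho X\setminus X)=n\ \text{and}\ \rho\in\operatorname{TBM}(X)\}.$$
   Context: $\mathbb N=\{1,2,\dots\}$. $\beta X$ is the Stone-Čech compactification of $X$. Compactifications are Hausdorff. Two compactifications $\alpha X,\gamma X$ of $X$ are equivalent, written $\alpha X\approx\gamma X$, if there is a homeomorphism $f:\alpha X\to\gamma X$ with $f|_X$ the identity map on $X$. The supremum is taken with respect to the usual order on (equivalence classes of) compactifications of $X$: $\alpha X\ge\gamma X$ iff there is a continuous map $\alpha X\to\gamma X$ restricting to the identity on $X$. A metric $\rho$ on $X$ is totally bounded if $(X,\rho)$ is a totally bounded metric space. For a metric space $(X,\rho)$, let $U_\rho^*(X)$ be the set of all bounded uniformly continuous functions $X\to\mathbb R$. The Smirnov compactification $u_\rho X$ of $(X,\rho)$ is the compactification of $X$ associated with the closed subring $U_\rho^*(X)$ of $C^*(X)$ (the Banach algebra of bounded continuous real-valued functions with the sup-norm); concretely, it is the closure of $e(X)$ in $\prod_{f\in U_\rho^*(X)}[\inf f(X),\sup f(X)]$, where $e(x)=(f(x))_{f}$ is the evaluation map, and $X$ is identified with $e(X)$. $\dim$ is the covering dimension, $\operatorname{ind}$ the small inductive dimension and $\operatorname{Ind}$ the large inductive dimension.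 For a normal space $Y$: $\operatorname{Ind}Y=-1$ iff $Y=\emptyset$; for $n\ge 0$, $\operatorname{Ind}Y\le n$ iff for every pair $A,B$ of disjoint closed subsets of $Y$ there is a partition $L$ between $A$ and $B$ (a closed set $L\subset Y$ for which there are disjoint open sets $U\supset A$, $V\supset B$ with $Y\setminus L=U\cup V$) such that $\operatorname{Ind}L\le n-1$. $\operatorname{ind}$ is defined in the same way with $A$ restricted to be a single point. *)

(* Defs.v *)
From HB Require Import structures.
From mathcomp Require Import all_boot all_order all_algebra.
From mathcomp Require Import all_classical all_reals all_analysis.

Set Implicit Arguments.
Unset Strict Implicit.
Unset Printing Implicit Defensive.

Import Order.TTheory GRing.Theory Num.Theory.
Import numFieldNormedType.Exports.

Local Open Scope classical_set_scope.
Local Open Scope ring_scope.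

Definition separable_space (X : topologicalType) : Prop :=
  exists2 D : set X, countable D & dense D.

(* Metrics are plain functions, and not instances of [metricType], because
   many different metrics on one and the same space are considered. *)
Record compatible_metric (R : realType) (X : topologicalType) := CompatibleMetric {
  mdist_of :> X -> X -> R ;
  cmetric_refl : forall x, mdist_of x x = 0 ;
  cmetric_eq : forall x y, mdist_of x y = 0 -> x = y ;
  cmetric_sym : forall x y, mdist_of x y = mdist_of y x ;
  cmetric_triangle : forall x y z,
    mdist_of x z <= mdist_of x y + mdist_of y z ;
  cmetric_nbhs : forall (x : X) (U : set X),
    nbhs x U <-> exists2 e : R, 0 < e & [set y | mdist_of x y < e] `<=` U }.

Definition metrizable (R : realType) (X : topologicalType) : Prop :=
  inhabited (compatible_metric R X).

Definition totally_bounded (R : realType) (X : topologicalType)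
    (rho : compatible_metric R X) : Prop :=
  forall e : R, 0 < e ->
    exists2 A : set X, finite_set A & forall x, exists2 a, A a & rho a x < e.

Record compactification (X : topologicalType) := Compactification {
  cspace :> topologicalType ;
  cemb : X -> cspace ;
  cspace_compact : compact [set: cspace] ;
  cspace_hausdorff : hausdorff_space cspace ;
  cemb_inj : injective cemb ;
  cemb_continuous : continuous cemb ;
  cemb_open : forall U : set X, open U ->
    exists2 V : set cspace, open V & cemb @^-1` V = U ;
  cemb_dense : dense (range cemb) }.

Arguments cemb {X} c x.

Definition cle (X : topologicalType) (K L : compactification X) : Prop :=
  exists2 f : L -> K, continuous f & forall x, f (cemb L x) = cemb K x.

Definition cequiv (X : topologicalType) (K L : compactification X) : Prop :=
  exists f : K -> L, exists g : L -> K,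
    [/\ continuous f, continuous g, cancel f g, cancel g f &
        forall x, f (cemb K x) = cemb L x].

(* [s] represents the supremum, in the poset of equivalence classes, of the
   classes of the members of [S]; [S] is not a [set (compactification X)]
   because the universe of [set] is too small. *)
Definition is_csup (X : topologicalType) (S : compactification X -> Prop)
    (s : compactification X) : Prop :=
  (forall K, S K -> cle K s) /\
  (forall t, (forall K, S K -> cle K t) -> cle s t).

Definition remainder (X : topologicalType) (K : compactification X) :
  topologicalType := set_type (~` range (cemb K)).

Definition bounded_real (R : realType) (X : Type) (f : X -> R) : Prop :=
  exists M : R, forall x, `|f x| <= M.

(* Just enough for the evaluation map of the family to be an embedding; the
   compactification [eval_compactification] below is the closure of its image
   in the product of the intervals [inf f(X), sup f(X)]. *)
Record eval_family (R : realType) (X : topologicalType) := EvalFamily {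
  family_set :> set (X -> R) ;
  family_continuous : forall f, family_set f -> continuous f ;
  family_bounded : forall f, family_set f -> bounded_real f ;
  family_separates :
    separate_points_from_closed (fun f : set_type family_set => \val f) }.

Definition range_itv (R : realType) (X : Type) (f : X -> R) : set R :=
  `[inf (range f), sup (range f)].

Lemma mem_range_itv (R : realType) (X : Type) (f : X -> R) :
  bounded_real f -> forall x, f x \in range_itv f.
Proof.
move=> [M fM] x; rewrite inE /range_itv /= in_itv /=; apply/andP; split.
- apply: ge_inf; last by exists x.
  by exists (- M) => _ [y _ <-]; have := fM y; rewrite ler_norml => /andP[].
- apply: ub_le_sup; last by exists x.
  by exists M => _ [y _ <-]; have := fM y; rewrite ler_norml => /andP[].
Qed.

Section evaluation.
Context (R : realType) (X : topologicalType) (F : eval_family R X).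

Definition eval_coord (f : set_type (family_set F)) (x : X) :
    set_type (range_itv (\val f)) :=
  exist _ (\val f x)
    (mem_range_itv (family_bounded (set_mem (valP f))) x).

Definition eval_cube : topologicalType :=
  prod_topology (fun f : set_type (family_set F) => set_type (range_itv (\val f))).

Definition eval_map : X -> eval_cube := join_product eval_coord.

Definition eval_closure : topologicalType :=
  set_type (closure (range eval_map)).

Lemma eval_map_closure x : eval_map x \in closure (range eval_map).
Proof. by rewrite inE; apply: subset_closure; exists x. Qed.

Definition eval_emb (x : X) : eval_closure :=
  exist _ (eval_map x) (eval_map_closure x).

Lemma eval_coord_continuous f : continuous (eval_coord f).
Proof.
apply/continuousP => _ [V oV <-].
have /continuousP := family_continuous (set_mem (valP f)).
exact.
Qed.

Lemma eval_coord_separates : separate_points_from_closed eval_coord.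
Proof.
move=> U x cU Ux; have [f nf] := @family_separates _ _ F U x cU Ux.
exists f => clf; apply: nf => B nB.
have /clf[_ [[y Uy <-] By]] :
    nbhs (eval_coord f x) ((fun z : set_type (range_itv (\val f)) => \val z) @^-1` B).
  by apply: initial_continuous.
by exists (\val f y); split => //; exists y.
Qed.

Lemma set_type_compact (T : topologicalType) (A : set T) :
  compact A -> compact [set: set_type A].
Proof.
move=> cA G PG _.
have GA : (set_val @ G) A.
  rewrite /fmap/=.
  by apply: (@filterS _ G _ setT) => [[y yA] _|]; [exact: set_mem|exact: filterT].
have [p [Ap clp]] := cA (set_val @ G) (fmap_proper_filter _ _) GA.
exists (exist _ p (mem_set Ap)); split => // C D GC [_ [[W oW <-]]] /= Wp WD.
have GC' : (set_val @ G) (set_val @` C).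
  by rewrite /fmap/=; apply: filterS GC => z Cz; exists z.
have /(clp _ _ GC')[_ [[z Cz <-] Wz]] : nbhs p W by exact: open_nbhs_nbhs.
by exists z; split => //; apply: WD.
Qed.

Lemma set_type_hausdorff (T : topologicalType) (A : set T) :
  hausdorff_space T -> hausdorff_space (set_type A).
Proof.
move=> hT p q pq; apply: val_inj; apply: hT => C D nC nD.
have [z [Cz Dz]] := pq (set_val @^-1` C) (set_val @^-1` D)
  (@initial_continuous _ _ set_val p C nC) (@initial_continuous _ _ set_val q D nD).
by exists (\val z).
Qed.

Lemma eval_closure_compact : compact [set: eval_closure].
Proof.
apply: set_type_compact.
apply: (@subclosed_compact _ _ [set: eval_cube]) => //.
  exact: closed_closure.
have cpt (f : set_type (family_set F)) : compact [set: set_type (range_itv (\val f))].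
  exact/set_type_compact/segment_compact.
have := @tychonoff _ (fun f : set_type (family_set F) =>
  set_type (range_itv (\val f))) (fun=> setT) cpt.
by congr compact; apply/seteqP; split.
Qed.

Lemma eval_closure_hausdorff : hausdorff_space eval_closure.
Proof.
apply: set_type_hausdorff; apply: hausdorff_product => f.
exact/set_type_hausdorff/Rhausdorff.
Qed.

Lemma eval_emb_continuous : continuous eval_emb.
Proof.
apply/continuousP => _ [V oV <-].
have /continuousP := join_product_continuous eval_coord_separates
  eval_coord_continuous.
exact.
Qed.

Hypothesis hX : hausdorff_space X.

Lemma eval_map_inj : set_inj [set: X] eval_map.
Proof.
exact: join_product_inj eval_coord_separates (hausdorff_accessible hX).
Qed.

Lemma eval_emb_inj : injective eval_emb.
Proof.
move=> x y /(congr1 val) xy; apply: eval_map_inj; rewrite ?inE//.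
Qed.

Lemma eval_emb_open (U : set X) : open U ->
  exists2 V : set eval_closure, open V & eval_emb @^-1` V = U.
Proof.
rewrite (join_product_initial eval_coord_separates eval_coord_continuous
  eval_map_inj) => -[W oW <-].
by exists (set_val @^-1` W) => //; exists W.
Qed.

Lemma eval_emb_dense : dense (range eval_emb).
Proof.
move=> O [[y yF] Oy] [V oV eV]; move: Oy; rewrite -eV => Vy.
have nV : nbhs y V by apply: open_nbhs_nbhs.
have [_ [[x _ <-] Vx]] := set_mem yF V nV.
by exists (eval_emb x); split => //; exists x.
Qed.

Definition eval_compactification : compactification X :=
  Compactification eval_closure_compact eval_closure_hausdorff
    eval_emb_inj eval_emb_continuous eval_emb_open eval_emb_dense.

End evaluation.

Definition tychonoff_space (X : topologicalType) : Prop :=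
  hausdorff_space X /\ completely_regular_space X.

Definition Cstar (R : realType) (X : topologicalType) : set (X -> R) :=
  [set f | continuous f /\ bounded_real f].

Lemma Cstar_separates (R : realType) (X : topologicalType) :
  tychonoff_space X ->
  separate_points_from_closed (fun f : set_type (@Cstar R X) => \val f).
Proof.
move=> [_ crX] U x cU Ux.
have /(@uniform_separatorP _ R)[f [cf f01 fx fU]] := crX _ _ cU Ux.
have Cf : f \in @Cstar R X.
  rewrite inE; split => //; exists 1 => y.
  have /f01 : range f (f y) by exists y.
  by rewrite /= in_itv /= => /andP[f0 f1]; rewrite ger0_norm.
exists (exist _ f Cf) => /= clf.
have f0 : f x = 0 by apply: fx; exists x.
have [|z [[y Uy <-]]] := clf (ball (f x) 1); first exact: nbhsx_ballx.
have -> : f y = 1 by apply: fU; exists y.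
by rewrite f0 /ball/= sub0r normrN normr1 ltxx.
Qed.

Definition Cstar_family (R : realType) (X : topologicalType)
    (hX : tychonoff_space X) : eval_family R X :=
  @EvalFamily R X (@Cstar R X) (fun f => @proj1 _ _) (fun f => @proj2 _ _)
    (Cstar_separates R hX).

Definition stone_cech (R : realType) (X : topologicalType)
    (hX : tychonoff_space X) : compactification X :=
  eval_compactification (Cstar_family R hX) hX.1.

Definition unif_continuous_for (R : realType) (X : topologicalType)
    (rho : compatible_metric R X) (f : X -> R) : Prop :=
  forall e : R, 0 < e -> exists2 d : R, 0 < d &
    forall x y, rho x y < d -> `|f x - f y| < e.

Definition Ustar (R : realType) (X : topologicalType)
    (rho : compatible_metric R X) : set (X -> R) :=
  [set f | unif_continuous_for rho f /\ bounded_real f].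

Section metric_facts.
Context (R : realType) (X : topologicalType) (rho : compatible_metric R X).

Lemma cmetric_ge0 x y : 0 <= rho x y.
Proof.
have := cmetric_triangle rho x y x.
by rewrite cmetric_refl (cmetric_sym rho y x) -mulr2n pmulrn_lge0.
Qed.

Lemma cmetric_hausdorff : hausdorff_space X.
Proof.
move=> p q pq; apply: (@cmetric_eq _ _ rho); apply/eqP; apply/negPn/negP => n0.
have e0 : 0 < rho p q / 2 by rewrite divr_gt0 // lt_neqAle eq_sym n0 cmetric_ge0.
have [||z [pz qz]] := pq [set z | rho p z < rho p q / 2]
    [set z | rho q z < rho p q / 2].
- by apply/(cmetric_nbhs rho); exists (rho p q / 2).
- by apply/(cmetric_nbhs rho); exists (rho p q / 2).
have := cmetric_triangle rho p z q; rewrite leNgt => /negP; apply.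
by rewrite (cmetric_sym rho z q) [ltRHS](splitr (rho p q)) ltrD.
Qed.

Lemma Ustar_continuous f : Ustar rho f -> continuous f.
Proof.
move=> [uf _] x U /nbhs_ballP[e /= e0 eU].
have [d d0 fd] := uf e e0.
by apply/(cmetric_nbhs rho); exists d => // y /= xy; apply/eU/fd.
Qed.

Lemma Ustar_separates :
  separate_points_from_closed (fun f : set_type (Ustar rho) => \val f).
Proof.
move=> U x cU Ux; pose f y := Num.min (rho x y) 1.
have f0 y : 0 <= f y by rewrite le_min cmetric_ge0 ler01.
have fD y z : f y <= f z + rho y z.
  rewrite /f [rho y z](cmetric_sym rho) {2}/Num.min; case: ifPn => _.
    by rewrite ge_min (cmetric_triangle rho).
  by rewrite ge_min lerDl cmetric_ge0 orbT.
have Uf : f \in Ustar rho.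
  rewrite inE; split; last first.
    by exists 1 => y; rewrite ger0_norm // ge_min lexx orbT.
  move=> e e0; exists e => // y z yz.
  rewrite ltr_norml ltrNl opprB; apply/andP; split.
    by rewrite (le_lt_trans _ yz)// lerBlDl (cmetric_sym rho) fD.
  by rewrite (le_lt_trans _ yz)// lerBlDl fD.
exists (exist _ f Uf) => /= clf.
have nU : nbhs x (~` U) by apply: open_nbhs_nbhs; split => //; exact: closed_openC.
have [e e0 eU] := (cmetric_nbhs rho x _).1 nU.
have fx : f x = 0 by rewrite /f cmetric_refl min_l.
have m0 : 0 < Num.min e 1 by rewrite lt_min e0 ltr01.
have [|_ [[y Uy <-]]] := clf (ball (f x) (Num.min e 1)); first exact: nbhsx_ballx.
rewrite /ball /= fx sub0r normrN ger0_norm // /f gt_min !lt_min ltxx andbF orbF.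
by move=> /andP[/eU].
Qed.

Definition Ustar_family : eval_family R X :=
  EvalFamily Ustar_continuous (fun f => @proj2 _ _) Ustar_separates.

Definition smirnov : compactification X :=
  eval_compactification Ustar_family cmetric_hausdorff.

End metric_facts.

Lemma metrizable_tychonoff (R : realType) (X : topologicalType) :
  metrizable R X -> tychonoff_space X.
Proof.
move=> [rho]; split; first exact: cmetric_hausdorff rho.
move=> x B cB Bx; apply/(@uniform_separatorP _ R).
have nB : nbhs x (~` B) by apply: open_nbhs_nbhs; split => //; exact: closed_openC.
have [e e0 eB] := (cmetric_nbhs rho x _).1 nB.
pose f y := Num.min (rho x y / e) 1.
have f0 y : 0 <= f y by rewrite le_min ler01 divr_ge0 ?cmetric_ge0 // ltW.
exists f; split.
- move=> y.
  apply: (@continuous_min R X (fun z => rho x z / e) (cst 1) y); last first.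
    exact: cst_continuous.
  apply: (@continuousM R X (rho x) (cst e^-1) y); last exact: cst_continuous.
  move=> U /nbhs_ballP[d /= d0 dU]; apply/(cmetric_nbhs rho); exists d => // z yz.
  apply: dU; rewrite /ball /= ltr_norml ltrNl opprB.
  apply/andP; split; rewrite (le_lt_trans _ yz)// lerBlDl.
    by rewrite (cmetric_triangle rho).
  by rewrite (cmetric_sym rho y z) (cmetric_triangle rho).
- by move=> _ [y _ <-]; rewrite /= in_itv /= f0 ge_min lexx orbT.
- by move=> _ [_ -> <-]; rewrite /= /f cmetric_refl mul0r min_l.
- move=> _ [y By <-]; rewrite /= /f min_r // ler_pdivlMr // mul1r leNgt.
  by apply/negP => /eB.
Qed.

(* Each dimension function [d] is given by the predicates [d Y < n], that is
   [d Y <= n - 1], for [n : nat], so that the value -1 needs no integers.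
   They are the usual dimensions on normal spaces (regular ones for
   [small_ind_lt]), the only ones for which they are meant. *)

(* The order condition is that each point lies in at most [n] members. *)
Definition covering_dim_lt (n : nat) (Y : topologicalType) : Prop :=
  forall C : set (set Y), finite_set C -> C `<=` open ->
    \bigcup_(U in C) U = setT ->
  exists D : set (set Y),
    [/\ finite_set D, D `<=` open, \bigcup_(V in D) V = setT,
        (forall V, D V -> exists2 U, C U & V `<=` U) &
        forall y, ([set V | D V /\ V y] #<= `I_n)%card].

Definition partition_between (Y : topologicalType) (A B L : set Y) : Prop :=
  closed L /\ exists U V : set Y,
    [/\ open U, open V, A `<=` U, B `<=` V & U `&` V = set0 /\ ~` L = U `|` V].

Fixpoint large_ind_lt (n : nat) (Y : topologicalType) : Prop :=
  if n is m.+1 then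
    forall A B : set Y, closed A -> closed B -> A `&` B = set0 ->
      exists2 L : set Y, partition_between A B L & large_ind_lt m (set_type L)
  else [set: Y] = set0.

Fixpoint small_ind_lt (n : nat) (Y : topologicalType) : Prop :=
  if n is m.+1 then
    forall (y : Y) (B : set Y), closed B -> ~ B y ->
      exists2 L : set Y, partition_between [set y] B L &
        small_ind_lt m (set_type L)
  else [set: Y] = set0.

Definition dim_eq (d_lt : nat -> topologicalType -> Prop)
    (Y : topologicalType) (n : nat) : Prop :=
  d_lt n.+1 Y /\ ~ d_lt n Y.

Definition covering_dim_eq := dim_eq covering_dim_lt.
Definition small_ind_eq := dim_eq small_ind_lt.
Definition large_ind_eq := dim_eq large_ind_lt.

(* Main.v *)
Require Import Defs.
From mathcomp Require Import all_boot all_order all_algebra.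
From mathcomp Require Import all_classical all_reals all_analysis.
From mathcomp Require Import ring lra zify.

(** The supremum is the Stone-Cech compactification itself.  Every Smirnov
    compactification lies below it, because uniformly continuous functions are
    continuous.  Conversely let [t] be a compactification above the whole
    family; [stone_cech] lies below [t] as soon as every bounded continuous
    [f] on [X] extends to [t] ([cle_eval]), and [f = (f + h) - h] for a bounded
    continuous [h] such that [f + h] and [h] are both uniformly continuous for
    metrics of the family, hence both extend to [t].

    The metrics.  Let [g] be a map from [X] to R^n, bounded and continuous,
    whose values outside every compact set are dense in the cube [0,1]^n.  A
    countable family of compactly supported bump functions generates the
    topology of [X] ([exists_bump_base]); the supremum distance of the sequence
    formed by the coordinates of [g] and by the bumps, divided by increasing
    weights, is a totally bounded metric ([sup_metric]).  On the remainder of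
    its Smirnov compactification the bumps vanish, so the extension of [g] is
    injective there, and its image contains the cube ([remainder_dimension]).
    So it is enough that [h] and [f + h] be first coordinates of such maps.
    As [X] is not compact it contains a sequence of distinct points that leaves
    every compact set, along which any bounded real sequence is interpolated by
    a continuous function (Tietze); the even terms of the sequence are used
    for [h] and the odd ones for [f + h].

    The dimension.  It remains to see that a compact space [Y] embedded in R^n
    with an image that contains the cube has all three dimensions equal to [n]
    ([coord_dimension]).
    - Lower bounds.  A set [A] is [zero_unstable] in degree [n] when every
      continuous map to R^n is uniformly close to one without zeros on [A].
      This property passes to finite unions of compact sets for trivial
      reasons, and it holds on [Y] if [ind Y < n], as well as if [dim Y < n].
      When the image of [Y] contains the cube it fails, by a combinatorial
      lemma of Kuhn that is equivalent to Brouwer's theorem.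
    - Upper bounds.  For [Ind], separate two closed sets by finite unions of
      boxes whose faces avoid a finite set of levels: each point of the
      partition then has one coordinate fewer outside the enlarged set of
      levels ([large_ind_free]).  For [dim], use [n + 1] translates of a grid
      of cubes; a point has only [n] coordinates, hence is missed by at most
      [n] of them ([covering_dim_coord]). *)

Set Implicit Arguments.
Unset Strict Implicit.
Unset Printing Implicit Defensive.

Import Order.TTheory GRing.Theory Num.Theory.
Import numFieldNormedType.Exports.

Local Open Scope ring_scope.

(** * Kuhn's cubical lemma *)
Section CubicalSperner.
Variable n : nat.
Implicit Types (S T : {set 'I_n}) (x y : 'I_n -> nat).

(** The vertex [x + 1_S] of the unit cube with lowest vertex [x]. *)
Definition corner S x : 'I_n -> nat := fun i => (x i + (i \in S))%N.

Lemma cornerD1 S i x : i \in S -> corner (S :\ i) (corner [set i] x) = corner S x.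
Proof.
move=> iS; apply/funext => j; rewrite /corner !inE.
by case: (eqVneq j i) => [->|_] /=; rewrite ?iS ?addn0 ?addn1.
Qed.

Lemma setD1C S i j : S :\ i :\ j = S :\ j :\ i.
Proof. by apply/setP => k; rewrite !inE andbCA. Qed.

Lemma addrr_F2 (a : 'F_2) : a + a = 0.
Proof. by apply: addrr_pchar2; rewrite pchar_Fp. Qed.

Lemma addr_F2_eq (a b : 'F_2) : a + b = 0 -> a = b.
Proof. by move=> /(congr1 (+%R^~ b)); rewrite -addrA addrr_F2 addr0 add0r. Qed.

Lemma sum_sym_pairs S (f : 'I_n -> 'I_n -> 'F_2) :
  (forall i j, f i j = f j i) ->
  \sum_(i in S) \sum_(j in S :\ i) f i j = 0.
Proof.
move=> fC; rewrite pair_big_dep /= (bigID (fun p : 'I_n * 'I_n => (p.1 < p.2)%N)) /=.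
rewrite [X in _ + X](reindex_inj (h := fun p : 'I_n * 'I_n => (p.2, p.1))) /=; last first.
  by move=> [a b] [c d] [-> ->].
rewrite [X in _ + X](eq_big (fun p : 'I_n * 'I_n => (p.1 \in S) && (p.2 \in S :\ p.1)
  && (p.1 < p.2)%N) (fun p => f p.1 p.2)); first exact: addrr_F2.
  move=> [i j] /=; rewrite !inE -!val_eqE /=.
  by case: (ltngtP i j) => _; case: (i \in S); case: (j \in S).
by move=> [i j] _ /=; apply: fC.
Qed.

Lemma exchange_pairs S (f : 'I_n -> 'I_n -> 'F_2) :
  \sum_(i in S) \sum_(j in S :\ i) f i j = \sum_(i in S) \sum_(j in S :\ i) f j i.
Proof.
rewrite (exchange_big_dep (mem S)) /=; last by move=> i j _; rewrite !inE => /andP[].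
apply: eq_bigr => i iS; apply: eq_bigl => j.
by rewrite !inE eq_sym iS andbT andbC.
Qed.

Variable l : nat -> ('I_n -> nat) -> 'F_2.

(** The cup product of the coboundaries of the labels [l 0], ..., [l k.-1],
    evaluated modulo 2 on the face of directions [S] at [x]: the sum, over the
    monotone paths of [k] unit steps that end at [x + 1_S], of the product of
    the increments of [l j] along the [j]-th step.  It is meant for
    [#|S| = k], where the paths start at [x]. *)
Fixpoint cup k S x : 'F_2 :=
  if k is m.+1 then
    \sum_(i in S) cup m (S :\ i) x * (l m (corner S x) + l m (corner (S :\ i) x))
  else 1.

(** The cup product of coboundaries is a cocycle: its sum over the facets of
    every cube vanishes. *)
Lemma cup_closed k S x :
  \sum_(i in S) (cup k (S :\ i) (corner [set i] x) + cup k (S :\ i) x) = 0.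
Proof.
elim: k S x => [|k IH] S x /=; first by rewrite big1 // => i _; apply: addrr_F2.
pose a i j := cup k (S :\ i :\ j) (corner [set i] x).
pose b i j := cup k (S :\ i :\ j) x.
pose L := l k (corner S x); pose L1 i := l k (corner (S :\ i) x).
have bC i j : b i j = b j i by rewrite /b setD1C.
transitivity (\sum_(i in S) \sum_(j in S :\ i)
  (a i j * L + a i j * L1 j + (b i j * L1 i + b i j * l k (corner (S :\ i :\ j) x)))).
  apply: eq_bigr => i iS; rewrite -big_split /=; apply: eq_bigr => j.
  rewrite !inE => /andP[ji jS]; rewrite !mulrDr cornerD1 //.
  have -> : corner (S :\ i :\ j) (corner [set i] x) = corner (S :\ j) x.
    by rewrite setD1C cornerD1 // !inE eq_sym ji.
  by [].
have s0 : \sum_(i in S) \sum_(j in S :\ i) b i j * l k (corner (S :\ i :\ j) x) = 0.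
  apply: sum_sym_pairs => i j; rewrite bC.
  by rewrite [S :\ i :\ j]setD1C.
have s1 : \sum_(i in S) \sum_(j in S :\ i) b i j * L = 0.
  by apply: sum_sym_pairs => i j; rewrite bC.
have s2 : \sum_(i in S) \sum_(j in S :\ i) b i j * L1 i =
          \sum_(i in S) \sum_(j in S :\ i) b i j * L1 j.
  by rewrite exchange_pairs; apply: eq_bigr => i _; apply: eq_bigr => j _; rewrite bC.
pose c i j := (a i j + b i j) * (L + L1 j).
transitivity (\sum_(i in S) \sum_(j in S :\ i) c i j).
  apply/eqP; rewrite -subr_eq0 -sumrB; apply/eqP.
  transitivity (\sum_(i in S) (\sum_(j in S :\ i) b i j * l k (corner (S :\ i :\ j) x)
      - \sum_(j in S :\ i) b i j * L
      + (\sum_(j in S :\ i) b i j * L1 i - \sum_(j in S :\ i) b i j * L1 j))).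
    apply: eq_bigr => i _; rewrite -!sumrB -big_split /=; apply: eq_bigr => j _.
    rewrite /c; ring.
  by rewrite big_split /= !sumrB s0 s1 s2 !subrr addr0.
rewrite exchange_pairs big1 // => i iS.
rewrite -mulr_suml -[RHS](mul0r (L + L1 i)); congr (_ * _).
rewrite -[RHS](IH (S :\ i) x); apply: eq_bigr => j _.
by rewrite /a /b [S :\ i :\ j]setD1C.
Qed.

Lemma cup_eq0 m k S x c : (m < k)%N ->
  (forall T, T \subset S -> l m (corner T x) = c) -> cup k S x = 0.
Proof.
elim: k S => [//|k IH] S; rewrite ltnS leq_eqVlt => /orP[/eqP->|mk] lc /=;
  rewrite big1 // => i iS.
  by rewrite !lc ?subsetDl // addrr_F2 mulr0.
rewrite IH ?mul0r // => T TS; apply: lc; apply: (fintype.subset_trans TS).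
exact: subsetDl.
Qed.

Variable p : nat.
Hypothesis l0 : forall (m : 'I_n) x, x m = 0%N -> l m x = 0.
Hypothesis l1 : forall (m : 'I_n) x, x m = p -> l m x = 1.

(** The lowest vertices of the unit cells, of directions [S], of the face
    [x_j = p] ([j] not in [S]) of the cube [0,p]^n. *)
Definition in_box S (x : {ffun 'I_n -> 'I_p.+1}) :=
  [forall j, if j \in S then (x j < p)%N else x j == p :> nat].

Definition grid_pt (x : {ffun 'I_n -> 'I_p.+1}) : 'I_n -> nat := fun i => x i.

Definition set_coord (x : 'I_n -> nat) i t : 'I_n -> nat := fun j => if j == i then t else x j.

Lemma sum_box_split S i (f : ('I_n -> nat) -> 'F_2) : i \in S ->
  \sum_(x | in_box S x) f (grid_pt x) =
  \sum_(x | in_box (S :\ i) x) \sum_(t < p) f (set_coord (grid_pt x) i t).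
Proof.
move=> iS.
pose top (x : {ffun 'I_n -> 'I_p.+1}) : {ffun 'I_n -> 'I_p.+1} :=
  [ffun j => if j == i then ord_max else x j].
rewrite (partition_big top (in_box (S :\ i))) /=; last first.
  move=> x /forallP bx; apply/forallP => j; rewrite !inE ffunE.
  have := bx j; case: (eqVneq j i) => [->|ji] /=; rewrite ?eqxx /= => //.
apply: eq_bigr => y /forallP by_.
pose h (t : 'I_p) : {ffun 'I_n -> 'I_p.+1} :=
  [ffun j => if j == i then widen_ord (leqnSn p) t else y j].
case: (posnP p) => [p0|p_gt0].
  have noltp k : (k < p)%N -> false.
    by move=> /(leq_ltn_trans (leq0n k)); rewrite ltnNge leqn0 => /negP[]; apply/eqP.
  rewrite big1 ?big1 // => [t _|x /andP[/forallP /(_ i)]].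
    by have := noltp _ (ltn_ord t).
  by rewrite iS => /noltp.
pose h2 (x : {ffun 'I_n -> 'I_p.+1}) : 'I_p := insubd (Ordinal p_gt0) (x i : nat).
rewrite (reindex_onto h h2) /=; last first.
  move=> x /andP[/forallP bx /eqP tx]; apply/ffunP => j; rewrite !ffunE.
  have bxi : (x i < p)%N by have := bx i; rewrite iS.
  case: (eqVneq j i) => [->|ji]; last by rewrite -tx ffunE (negbTE ji).
  by apply: val_inj; rewrite /= /h2 val_insubd bxi.
apply: eq_big => [t|t _]; last first.
  by congr f; apply/funext => j; rewrite /grid_pt /set_coord /h ffunE; case: eqP.
apply/andP; split; last first.
  by apply/eqP/val_inj; rewrite /h2 val_insubd ffunE eqxx /= ltn_ord.
apply/andP; split.
  apply/forallP => j; rewrite ffunE; case: (eqVneq j i) => [->|ji]; first by rewrite iS /=.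
  by have := by_ j; rewrite !inE ji.
apply/eqP/ffunP => j; rewrite !ffunE; case: (eqVneq j i) => // ->.
apply: val_inj => /=; have := by_ i; rewrite !inE eqxx /= => /eqP ->.
by [].
Qed.

Lemma sum_telescope2 (f : nat -> 'F_2) m :
  \sum_(t < m) (f t.+1 + f t) = f m + f 0%N.
Proof.
elim: m => [|m IH]; first by rewrite big_ord0 addrr_F2.
by rewrite big_ord_recr /= IH addrC -addrA [f m + (f m + _)]addrA addrr_F2 add0r.
Qed.

Lemma sum_box_telescope S i (f : ('I_n -> nat) -> 'F_2) : i \in S ->
  \sum_(x | in_box S x) (f (corner [set i] (grid_pt x)) + f (grid_pt x)) =
  \sum_(x | in_box (S :\ i) x) (f (grid_pt x) + f (set_coord (grid_pt x) i 0)).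
Proof.
move=> iS; rewrite (sum_box_split (fun x => f (corner [set i] x) + f x) iS).
apply: eq_bigr => x /forallP bx.
have -> : f (grid_pt x) = f (set_coord (grid_pt x) i p).
  congr f; apply/funext => j; rewrite /set_coord; case: (eqVneq j i) => [->|//].
  by have := bx i; rewrite !inE eqxx /= => /eqP.
rewrite -(sum_telescope2 (fun t => f (set_coord (grid_pt x) i t))); apply: eq_bigr => t _.
congr (f _ + _); apply/funext => j; rewrite /corner /set_coord inE.
by case: eqP => _; rewrite ?addn1 ?addn0.
Qed.

(** The total of [cup k] over the face [x_j = p] ([k <= j]) is 1.  As
    [cup k] is closed, the total of [cup k.+1] is a sum of telescopes, in which
    only the two faces orthogonal to each direction [i <= k] survive.  For
    [i < k] the label [l i] is constant there, and the product vanishes; for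
    [i = k] the label [l k] is 0 on one face and 1 on the other, and the total
    of [cup k] is left. *)
Lemma sum_cup k : (k <= n)%N ->
  \sum_(x | in_box [set j : 'I_n | (j < k)%N] x) cup k [set j : 'I_n | (j < k)%N] (grid_pt x) = 1.
Proof.
elim: k => [_|k IH kn] /=.
  rewrite (big_pred1 [ffun=> ord_max]) // => x /=.
  apply/forallP/eqP => [bx|-> j]; last by rewrite !inE ffunE /=.
  by apply/ffunP => j; rewrite ffunE; apply: val_inj => /=; have := bx j; rewrite inE /= => /eqP.
set S := [set j : 'I_n | (j < k.+1)%N]; pose f i x := cup k (S :\ i) x * l k (corner (S :\ i) x).
transitivity (\sum_(i in S) \sum_(x : {ffun 'I_n -> 'I_p.+1} | in_box S x)
    (f i (corner [set i] (grid_pt x)) + f i (grid_pt x))).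
  rewrite [RHS]exchange_big /=; apply: eq_bigr => x _.
  have /addr_F2_eq E : \sum_(i in S) cup k (S :\ i) (corner [set i] (grid_pt x)) +
    \sum_(i in S) cup k (S :\ i) (grid_pt x) = 0 by rewrite -big_split /= cup_closed.
  under eq_bigr do rewrite mulrDr.
  rewrite big_split /= -mulr_suml -E mulr_suml [RHS]big_split /=; congr (_ + _).
  by apply: eq_bigr => i iS; rewrite /f cornerD1.
pose ik := Ordinal kn; have ikS : ik \in S by rewrite inE /=.
have SE : S :\ ik = [set j : 'I_n | (j < k)%N].
  by apply/setP => j; rewrite !inE -val_eqE /= ltnS ltn_neqAle.
have ncorner T (i : 'I_n) x : i \notin T -> corner T x i = x i.
  by move=> iT; rewrite /corner (negbTE iT) addn0.
rewrite (bigD1 ik) //= [X in _ + X]big1 => [|i /andP[iS ik']].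
  rewrite addr0 sum_box_telescope // SE -[RHS](IH (ltnW kn)).
  apply: eq_bigr => x /forallP bx; rewrite /f SE.
  have ikN : ik \notin [set j : 'I_n | (j < k)%N] by rewrite inE /= ltnn.
  have := l0 (m := ik); have := l1 (m := ik); rewrite /= => -> ; last first.
    by rewrite ncorner //; have := bx ik; rewrite (negbTE ikN) => /eqP.
  by move=> ->; rewrite ?mulr1 ?mulr0 ?addr0 // ncorner // /set_coord eqxx.
rewrite sum_box_telescope // big1 // => x /forallP bx.
have ik2 : (i < k)%N.
  by move: iS ik'; rewrite inE ltnS leq_eqVlt -val_eqE /= => /orP[/eqP->|//]; rewrite eqxx.
have iN T : T \subset S :\ i -> i \notin T.
  by move=> /fintype.subsetP TS; apply/negP => /TS; rewrite !inE eqxx.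
rewrite /f (cup_eq0 (m := i) (c := 1)) // ?mul0r ?add0r; last first.
  move=> T TS; apply: l1; rewrite ncorner ?iN //.
  by have := bx i; rewrite !inE eqxx /= => /eqP.
rewrite (cup_eq0 (m := i) (c := 0)) ?mul0r // => T TS.
by apply: l0; rewrite ncorner ?iN // /set_coord eqxx.
Qed.

End CubicalSperner.

(** Kuhn's lemma: if the [m]-th label is false where [x m = 0] and true where
    [x m = p], then every label is non-constant on the vertices of some unit
    cube. *)
Lemma kuhn n p (l : 'I_n -> ('I_n -> nat) -> bool) :
  (forall m x, x m = 0%N -> l m x = false) ->
  (forall m x, x m = p -> l m x = true) ->
  exists2 x : 'I_n -> nat, (forall i, x i < p)%N &
    forall m, exists T T', l m (corner T x) /\ ~~ l m (corner T' x).
Proof.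
move=> l0 l1.
pose L k x : 'F_2 := (if insub k is Some m then l m x else false)%:R.
have LE (m : 'I_n) x : L m x = (l m x)%:R by rewrite /L valK.
have L0 (m : 'I_n) x : x m = 0%N -> L m x = 0 by move=> xm; rewrite LE l0.
have L1 (m : 'I_n) x : x m = p -> L m x = 1 by move=> xm; rewrite LE l1.
have ST : [set j : 'I_n | (j < n)%N] = [set: 'I_n].
  by apply/setP => j; rewrite !inE ltn_ord.
have := sum_cup L0 L1 (leqnn n); rewrite ST => H.
have {H} : \sum_(x : {ffun 'I_n -> 'I_p.+1} | in_box [set: 'I_n] x)
    cup L n [set: 'I_n] (grid_pt x) != 0.
  by rewrite H oner_eq0.
move=> sn0.
have [x /forallP bx cn0] : exists2 x : {ffun 'I_n -> 'I_p.+1}, in_box [set: 'I_n] x &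
    cup L n [set: 'I_n] (grid_pt x) != 0.
  apply/exists_inP; apply: contraNT sn0 => /exists_inPn H.
  by apply/eqP; apply: big1 => x /H /negPn /eqP.
exists (grid_pt x) => [i|m]; first by have := bx i; rewrite inE.
have [[T lT]|HT] := pselect (exists T, l m (corner T (grid_pt x))); last first.
  case/eqP: cn0; apply: (cup_eq0 (m := m) (c := 0)) => // T _; rewrite LE.
  by case E : l => //; case: HT; exists T.
have [[T' lT']|HT'] := pselect (exists T, ~~ l m (corner T (grid_pt x))).
  by exists T, T'.
case/eqP: cn0; apply: (cup_eq0 (m := m) (c := 1)) => // T' _; rewrite LE.
by case E : l => //; case: HT'; exists T'; rewrite E.
Qed.

Local Open Scope classical_set_scope.
Local Open Scope ring_scope.

(** * Compactness and continuous real functions *)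

Lemma compact_subcover (T : topologicalType) (I : choiceType) (D : set I) (U : I -> set T)
    (A : set T) : compact A -> (forall i, D i -> open (U i)) ->
  (forall x, A x -> exists2 i, D i & U i x) ->
  exists2 s : seq I, (forall i, i \in s -> D i) &
    forall x, A x -> exists2 i, i \in s & U i x.
Proof.
move=> /compact_near_coveringP cA oU AU.
pose G : set_system (seq I) :=
  filter_from [set: seq I] (fun s : seq I => [set t : seq I | {subset s <= t}]).
have FG : Filter G.
  apply: filter_from_filter; first by exists [::].
  move=> s t _ _; exists (s ++ t) => // u su.
  by split => i ij; apply: su; rewrite mem_cat ij ?orbT.
pose P (s : seq I) x := exists2 i, i \in s & D i /\ U i x.
have [x /AU[i Di Ux]|s _ sP] := cA _ G P FG.
  exists (U i, [set t : seq I | {subset [:: i] <= t}]) => /=.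
    split; first by apply: open_nbhs_nbhs; split => //; exact: oU.
    by exists [:: i].
  by move=> [y t] /= [Uy it]; exists i => //; apply: it; rewrite inE.
exists [seq i <- s | `[< D i >]] => [i|x Ax].
  by rewrite mem_filter => /andP[/asboolP].
have [|i si [Di Ux]] := sP s _ x Ax; first by [].
by exists i => //; rewrite mem_filter si andbT; apply/asboolP.
Qed.

Lemma closed_seq_bigcup (T : topologicalType) (I : choiceType) (s : seq I) (C : I -> set T) :
  (forall i, i \in s -> closed (C i)) ->
  closed [set x | exists2 i, i \in s & C i x].
Proof.
move=> cC; suff -> : [set x | exists2 i, i \in s & C i x] = \big[setU/set0]_(i <- s) C i.
  exact: closed_bigsetU.
by rewrite -bigcup_seq; apply/seteqP; split => x [i]; exists i.
Qed.

Lemma open_seq_bigcup (T : topologicalType) (I : choiceType) (s : seq I) (C : I -> set T) :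
  (forall i, i \in s -> open (C i)) ->
  open [set x | exists2 i, i \in s & C i x].
Proof.
move=> oC; suff -> : [set x | exists2 i, i \in s & C i x] = \bigcup_(i in [set` s]) C i.
  exact: bigcup_open.
by apply/seteqP; split => x [i]; exists i.
Qed.

Lemma closed_forall (T : topologicalType) (I : Type) (C : I -> set T) :
  (forall i, closed (C i)) -> closed [set x | forall i, C i x].
Proof.
move=> cC; suff -> : [set x | forall i, C i x] = \bigcap_(i in setT) C i.
  by apply: closed_bigI => i _; exact: cC.
by apply/seteqP; split => x Cx i; [move=> _; exact: Cx|exact: Cx].
Qed.

Lemma dense_closed (T : topologicalType) (S C : set T) :
  dense S -> closed C -> S `<=` C -> forall x, C x.
Proof.
move=> dS cC SC x; apply: contrapT => Cx.
have [||y [Cy /SC]] := dS (~` C); [by exists x|exact: closed_openC|exact: Cy].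
Qed.

Section RealFunctions.
Variable R : realType.

Lemma continuousRP (T : topologicalType) (f : T -> R) :
  continuous f <-> forall x e, 0 < e -> \forall y \near x, `|f x - f y| < e.
Proof.
split=> [cf x e e0|cf x]; first by have /cvgrPdist_lt/(_ e e0) := cf x.
by apply/cvgrPdist_lt => e e0; exact: cf.
Qed.

Lemma closed_leR (T : topologicalType) (f g : T -> R) :
  continuous f -> continuous g -> closed [set x | f x <= g x].
Proof.
move=> cf cg; suff -> : [set x | f x <= g x] = (fun x => f x - g x) @^-1` [set x | x <= 0].
  apply: preimage_closed => [x _|]; last exact: closed_le.
  by apply: cvgB; [exact: cf|exact: cg].
by apply/seteqP; split => x /=; rewrite subr_le0.
Qed.

Lemma open_ltR (T : topologicalType) (f g : T -> R) :
  continuous f -> continuous g -> open [set x | f x < g x].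
Proof.
move=> cf cg; rewrite -closedC; suff -> : ~` [set x | f x < g x] = [set x | g x <= f x].
  exact: closed_leR.
by apply/seteqP; split => x /=; rewrite leNgt => /negP.
Qed.

Lemma continuous_dist (T : topologicalType) (f g : T -> R) :
  continuous f -> continuous g -> continuous (fun x => `|f x - g x|).
Proof. by move=> cf cg x; apply: cvg_norm; apply: cvgB; [exact: cf|exact: cg]. Qed.

Lemma continuous_mulr (T : topologicalType) (f : T -> R) c :
  continuous f -> continuous (fun x => f x * c).
Proof. by move=> cf x; apply: cvgM; [exact: cf|exact: cvg_cst]. Qed.

Lemma continuous_fsum (T : topologicalType) n (f : 'I_n -> T -> R) :
  (forall i, continuous (f i)) -> continuous (fun x => \sum_i f i x).
Proof.
move=> cf x; apply: cvg_big => [|i _]; last exact: cf.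
exact: add_continuous.
Qed.

Lemma continuous_comp_fun (S T U : topologicalType) (f : S -> T) (g : T -> U) :
  continuous f -> continuous g -> continuous (fun x => g (f x)).
Proof. by move=> cf cg x; apply: continuous_comp; [exact: cf|exact: cg]. Qed.

Lemma continuous_val (T : topologicalType) (A : set T) :
  continuous (fun x : set_type A => \val x).
Proof. exact: initial_continuous. Qed.

Lemma compact_lower_bound (T : topologicalType) (A : set T) (f : T -> R) :
  compact A -> continuous f -> (forall x, A x -> 0 < f x) ->
  exists2 d, 0 < d & forall x, A x -> d <= f x.
Proof.
move=> cA cf f0; have [[a Aa]|A0] := pselect (A !=set0); last first.
  by exists 1 => // x Ax; case: A0; exists x.
have [||c] := compact_EVT_min (f := f) _ cA; [by exists a|exact: continuous_subspaceT|].
rewrite inE => Ac fc; exists (f c); first exact: f0.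
by move=> x Ax; apply: fc; rewrite inE.
Qed.

Lemma open_neq0 (T : topologicalType) (f : T -> R) :
  continuous f -> open [set x | f x != 0].
Proof.
move=> cf; suff -> : [set x | f x != 0] = [set x | 0 < `|f x - 0|].
  apply: open_ltR; first exact: cst_continuous.
  by apply: continuous_dist => //; exact: cst_continuous.
by apply/seteqP; split => x /=; rewrite subr0 normr_gt0.
Qed.

Lemma continuous_dense_eq (T : topologicalType) (S : set T) (f g : T -> R) :
  dense S -> continuous f -> continuous g -> (forall x, S x -> f x = g x) ->
  forall x, f x = g x.
Proof.
move=> dS cf cg fg x; apply/eqP; rewrite -subr_eq0 -normr_le0.
apply: (dense_closed dS (C := [set z | `|f z - g z| <= 0])).
  by apply: closed_leR; [exact: continuous_dist|exact: cst_continuous].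
by move=> z /fg /= ->; rewrite subrr normr0.
Qed.

Lemma sum_norm_lt n (a : 'I_n -> R) d : 0 < d ->
  (forall i, `|a i| < d / n.+1%:R) -> \sum_i `|a i| < d.
Proof.
move=> d0 ad; apply: (@le_lt_trans _ _ (\sum_(i < n) d / n.+1%:R)).
  by apply: ler_sum => i _; apply: ltW.
rewrite sumr_const card_ord -[ltLHS]mulr_natr mulrAC ltr_pdivrMr ?ltr0n //.
by rewrite ltr_pM2l // ltr_nat.
Qed.

Lemma open_coord_close n (Y : topologicalType) (g : 'I_n -> Y -> R) d y :
  (forall i, continuous (g i)) -> open [set z | forall i, `|g i y - g i z| < d].
Proof.
move=> cg; suff -> : [set z | forall i, `|g i y - g i z| < d] =
    ~` [set z | exists2 i, i \in enum 'I_n & d <= `|g i y - g i z|].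
  apply: closed_openC; apply: closed_seq_bigcup => i _.
  apply: closed_leR; first by move=> x; exact: cvg_cst.
  by apply: continuous_dist => // x; exact: cvg_cst.
apply/seteqP; split => z yz; first by move=> [i _]; rewrite leNgt yz.
by move=> i; rewrite ltNge; apply/negP => H; apply: yz; exists i => //; rewrite mem_enum.
Qed.

(** A jointly injective finite family [g] of continuous functions on a compact
    space [Y]: the coordinates of an embedding of [Y] into R^n.  Closeness of
    the coordinates plays the role of a metric on [Y]. *)
Section Coordinates.
Variables (n : nat) (Y : topologicalType) (g : 'I_n -> Y -> R).
Hypothesis cY : compact [set: Y].
Hypothesis cg : forall i, continuous (g i).
Hypothesis ginj : forall y z, (forall i, g i y = g i z) -> y = z.

Definition coord_close d y z := forall i, `|g i y - g i z| < d.

Let m y z := \sum_i `|g i y - g i z|.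

Let m_gt0 y z : y <> z -> 0 < m y z.
Proof.
move=> yz; rewrite lt_def sumr_ge0 ?andbT => [|i _ //].
apply/eqP => m0; apply: yz; apply: ginj => i.
apply/eqP; rewrite -subr_eq0 -normr_le0 -m0 /m (bigD1 i) //= lerDl.
by apply: sumr_ge0.
Qed.

(** Heine's theorem in coordinates. *)
Lemma coord_unif_continuous (G : Y -> R) e : continuous G -> 0 < e ->
  exists2 d, 0 < d & forall y z, coord_close d y z -> `|G y - G z| < e.
Proof.
move=> cG e0.
have cfst (f : Y -> R) : continuous f -> continuous (fun p : Y * Y => f p.1).
  by move=> cf; apply: continuous_comp_fun cf => p; exact: cvg_fst.
have csnd (f : Y -> R) : continuous f -> continuous (fun p : Y * Y => f p.2).
  by move=> cf; apply: continuous_comp_fun cf => p; exact: cvg_snd.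
pose A := [set p : Y * Y | e <= `|G p.1 - G p.2|].
have cA : compact A.
  apply: (@subclosed_compact _ _ ([set: Y] `*` [set: Y])) => //.
    apply: closed_leR; first by move=> x; exact: cvg_cst.
    by apply: continuous_dist; [exact: cfst|exact: csnd].
  exact: compact_setX.
have [|p|d d0 Ad] := @compact_lower_bound _ A (fun p => m p.1 p.2) cA.
- by apply: continuous_fsum => i; apply: continuous_dist; [exact: cfst|exact: csnd].
- move=> /= Ap; apply: m_gt0 => p12; move: Ap; rewrite /A/= p12 subrr normr0.
  by rewrite leNgt e0.
exists (d / n.+1%:R) => [|y z yz]; first by rewrite divr_gt0.
rewrite ltNge; apply/negP => /(Ad (y, z)); apply/negP; rewrite -ltNge /=.
exact: sum_norm_lt.
Qed.

Lemma coord_nbhs y (U : set Y) : nbhs y U ->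
  exists2 d, 0 < d & forall z, coord_close d y z -> U z.
Proof.
rewrite nbhsE => -[V [oV Vy] VU].
have cA : compact (~` V).
  by apply: (@subclosed_compact _ _ setT) => //; exact: open_closedC.
have [|z|d d0 Ad] := @compact_lower_bound _ (~` V) (m y) cA.
- apply: continuous_fsum => i; apply: continuous_dist; last exact: cg.
  by move=> x; exact: cvg_cst.
- by move=> Vz; apply: m_gt0 => yz; apply: Vz; rewrite -yz.
exists (d / n.+1%:R) => [|z yz]; first by rewrite divr_gt0.
apply: VU; apply: contrapT => /Ad; apply/negP; rewrite -ltNge.
exact: sum_norm_lt.
Qed.

(** A Lebesgue number of the open cover [C]. *)
Lemma coord_lebesgue (C : set (set Y)) : C `<=` open ->
  \bigcup_(U in C) U = setT ->
  exists2 d, 0 < d & forall y, exists2 U, C U & forall z, coord_close d y z -> U z.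
Proof.
move=> oC CT.
have /compact_near_coveringP cY' := cY.
pose P (d : R) y := exists2 U, C U & forall z, coord_close d y z -> U z.
have [e /= e0 eP] : \forall d \near (0 : R)^'+, [set: Y] `<=` P d; last first.
  exists (e / 2); first by rewrite divr_gt0.
  move=> y; apply: (eP (e / 2)) => //=; last by rewrite divr_gt0.
  by rewrite /ball /= sub0r normrN gtr0_norm ?divr_gt0 // [ltRHS]splitr ltrDl divr_gt0.
apply: cY' => y _.
have [U CU Uy] : (\bigcup_(U in C) U) y by rewrite CT.
have [|d d0 dU] := @coord_nbhs y U; first by apply: open_nbhs_nbhs; split => //; exact: oC.
exists ([set z | coord_close (d / 2) y z], [set e | e < d / 2]).
  split; last by apply: nbhs_right_lt; rewrite divr_gt0.
  apply: filter_forall => i /=.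
  by have /continuousRP := @cg i; apply; rewrite divr_gt0.
move=> [z e] /= [yz ed]; exists U => // w zw; apply: dU => i.
rewrite -(subrKA (g i z)) (le_lt_trans (ler_normD _ _)) //.
by rewrite [ltRHS](splitr d) ltrD ?yz // (lt_trans (zw i)).
Qed.

End Coordinates.
End RealFunctions.

(** * Lower bounds for the dimensions *)

Section Unstable.
Variable R : realType.

(** The value 0 is unstable on [A] in degree [n]: every continuous map [F] from
    [Y] to R^n is uniformly close to a continuous map without zeros on [A]. *)
Definition zero_unstable n (Y : topologicalType) (A : set Y) : Prop :=
  forall (F : 'I_n -> Y -> R) (e : R), 0 < e -> (forall i, continuous (F i)) ->
  exists G : 'I_n -> Y -> R,
    [/\ forall i, continuous (G i), forall i y, `|G i y - F i y| <= e &
        forall y, A y -> exists i, G i y != 0].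

(** This is the sum theorem of the theory: once [F] has been moved off 0 on the
    compact set [A], it stays away from 0 on [A] by a positive distance, and
    can be moved again by less than that to have no zeros on [B]. *)
Lemma zero_unstableU n (Y : topologicalType) (A B : set Y) : compact A ->
  zero_unstable n A -> zero_unstable n B -> zero_unstable n (A `|` B).
Proof.
move=> cA uA uB F e e0 cF.
have e2 : 0 < e / 2 by rewrite divr_gt0.
have [G1 [cG1 G1F G1A]] := uA F _ e2 cF.
have [||d d0 Ad] := @compact_lower_bound R _ A (fun y => \sum_i `|G1 i y|) cA.
- by apply: continuous_fsum => i y; apply: cvg_norm; exact: cG1.
- move=> y /G1A[i Gi]; rewrite (bigD1 i) //= ltr_pwDl ?normr_gt0 //.
  exact: sumr_ge0.
have d1 : 0 < d / n.+1%:R by rewrite divr_gt0.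
have [|G2 [cG2 G2G G2B]] := uB G1 (Num.min (e / 2) (d / n.+1%:R / 2)) _ cG1.
  by rewrite lt_min e2 divr_gt0.
exists G2; split => // [i y|y [Ay|/G2B//]].
  rewrite -(subrKA (G1 i y)) (le_trans (ler_normD _ _)) // [leRHS]splitr.
  by rewrite lerD ?G1F // (le_trans (G2G i y)) // ge_min lexx.
apply: contrapT => G20; have := Ad y Ay; apply/negP; rewrite -ltNge.
apply: sum_norm_lt => // i; have G2i : G2 i y = 0.
  by apply: contrapT => /eqP G2i; apply: G20; exists i.
have := G2G i y; rewrite G2i sub0r normrN => /le_lt_trans; apply.
by rewrite gt_min [X in _ || X]ltr_pdivrMr // ltr_pMr // ltr1n orbT.
Qed.

Lemma zero_unstable_seq n (Y : topologicalType) (I : eqType) (s : seq I) (C : I -> set Y) :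
  (forall i, i \in s -> compact (C i)) -> (forall i, i \in s -> zero_unstable n (C i)) ->
  zero_unstable n [set y | exists2 i, i \in s & C i y].
Proof.
elim: s => [_ _ F e e0 cF|i s IH cC uC].
  by exists F; split => // [i y|y []//]; rewrite subrr normr0 ltW.
suff -> : [set y | exists2 k, k \in i :: s & C k y] =
    C i `|` [set y | exists2 k, k \in s & C k y].
  apply: zero_unstableU; [exact/cC/mem_head|exact/uC/mem_head|].
  by apply: IH => k ks; [apply: cC|apply: uC]; rewrite inE ks orbT.
apply/seteqP; split => y /=.
  by move=> [k]; rewrite inE => /orP[/eqP->|ks] Cy; [left|right; exists k].
by move=> [Cy|[k ks Cy]]; [exists i|exists k] => //; rewrite inE ?eqxx ?ks ?orbT.
Qed.

(** Where the sign to be taken is prescribed on disjoint closed sets, adding a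
    Urysohn function of size [e] removes the zeros of [F]. *)
Lemma push_off_zero (Y : topologicalType) (P N : set Y) (F : Y -> R) e :
  normal_space Y -> closed P -> closed N -> P `&` N = set0 -> 0 < e ->
  continuous F -> (forall y, P y -> - e < F y) -> (forall y, N y -> F y < e) ->
  exists G : Y -> R, [/\ continuous G, forall y, `|G y - F y| <= e &
    forall y, P y \/ N y -> G y != 0].
Proof.
move=> nY cP cN PN e0 cF FP FN.
have [||h [ch hN hP he]] := @urysohn_ext_itv _ R nY N P (- e) e cN cP.
- by rewrite setIC.
- by rewrite gt0_cp.
exists (fun y => F y + h y); split.
- by move=> y; apply: cvgD; [exact: cF|exact: ch].
- move=> y; rewrite addrAC subrr add0r ler_norml.
  by have /he : range h (h y) by exists y.
- move=> y [Py|Ny].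
    have -> : h y = e by apply: hP; exists y.
    by rewrite gt_eqF // -ltrBlDr sub0r FP.
  have -> : h y = - e by apply: hN; exists y.
  by rewrite lt_eqF // subr_lt0 FN.
Qed.


(** If [ind Z < n.+1], cover [Z] by finitely many open sets on which the last
    coordinate of [F] oscillates little, cut out by partitions of [ind < n].
    By induction the first [n] coordinates can be moved to have no common zero
    on the union of the partitions.  On the set [Z0] of their remaining common
    zeros the members of the cover are clopen, so the sign of the last
    coordinate can be chosen on each of them. *)
Lemma small_ind_unstable n (Z Y : topologicalType) (j : Z -> Y) :
  compact [set: Z] -> compact [set: Y] -> hausdorff_space Y ->
  injective j -> continuous j -> small_ind_lt n Z -> zero_unstable n (range j).
Proof.
move=> + cY hY; have nY := compact_normal hY cY.
elim: n Z j => [|n IH] Z j cZ jinj cj indZ F e e0 cF.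
  exists F; split => // [i y|_ [z _ <-]]; first by case: i.
  by have : set0 z by rewrite -indZ.
pose f := F ord_max; have cfj : continuous (f \o j) by apply: continuous_comp_fun cj _; exact: cF.
have /choice[p Hp] (z : Z) : exists p : set Z * set Z * set Z,
    [/\ closed p.1.1, open p.1.2, open p.2,
        p.1.2 z & [/\ [set x | e <= `|f (j x) - f (j z)|] `<=` p.2,
        p.1.2 `&` p.2 = set0, ~` p.1.1 = p.1.2 `|` p.2 &
        small_ind_lt n (set_type p.1.1)]].
  have [||L [cL [U [V [oU oV zU BV [UV LUV]]]]] indL] :=
      indZ z [set x | e <= `|f (j x) - f (j z)|].
  - apply: closed_leR; first by move=> x; exact: cvg_cst.
    by apply: (continuous_dist cfj) => x; exact: cvg_cst.
  - by rewrite /= subrr normr0 leNgt e0.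
  by exists (L, U, V); split => //=; apply: zU.
have [z _|z _|s _ sZ] := @compact_subcover Z Z setT (fun z => (p z).1.2) setT cZ.
- by have [] := Hp z.
- by exists z => //; have [] := Hp z.
pose L z := (p z).1.1; pose jL z := j \o (fun x : set_type (L z) => \val x).
have cjL z : continuous (jL z) by apply: continuous_comp_fun => //; exact: continuous_val.
have cptL z : compact [set: set_type (L z)].
  apply: set_type_compact; apply: (subclosed_compact _ cZ) => //.
  by have [] := Hp z.
have [||G' [cG' G'F G'L]] := @zero_unstable_seq n Y _ s (fun z => range (jL z)) _ _
    (fun i => F (lift ord_max i)) e e0 (fun i => cF _).
- move=> z _; apply: continuous_compact; last exact: cptL.
  by apply: continuous_subspaceT; exact: cjL.
- move=> z _; apply: IH => //; [|exact: cjL|by have [_ _ _ _ []] := Hp z].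
  by move=> x y /jinj /val_inj.
pose Z0 := [set z | forall i, G' i (j z) = 0].
have cZ0 : closed Z0.
  suff -> : Z0 = [set z | \sum_i `|G' i (j z)| <= 0].
    apply: closed_leR; last by move=> x; exact: cvg_cst.
    apply: continuous_fsum => i z; apply: cvg_norm.
    by apply: (@continuous_comp_fun _ _ _ _ (G' i) cj); exact: cG'.
  apply/seteqP; split => z /= Gz; first by rewrite big1 // => i _; rewrite Gz normr0.
  move=> i; apply/eqP; rewrite -normr_le0; apply: le_trans Gz.
  by rewrite (bigD1 i) //= lerDl sumr_ge0.
have Z0L z x : z \in s -> Z0 x -> ((p z).1.2 x <-> ~ (p z).2 x).
  move=> zs Z0x; have [_ _ _ _ [_ UV LUV _]] := Hp z.
  have nL : ~ L z x.
    move=> Lx; have [|i] := G'L (j x); last by rewrite Z0x eqxx.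
    by exists z => //; exists (exist _ x (mem_set Lx)).
  have : ((p z).1.2 `|` (p z).2) x by rewrite -LUV.
  move=> UVx; split; last by case: UVx.
  by move=> Ux Vx; have : set0 x by rewrite -UV.
(* On [Z0], the union of the members of the cover with a centre where [f] is
   nonnegative is clopen; [P] is its trace on [Z0], and [N] the complement. *)
pose sp := [seq z <- s | 0 <= f (j z)].
pose P := Z0 `&` [set x | exists2 z, z \in sp & (~` (p z).2) x].
pose N := Z0 `&` ~` [set x | exists2 z, z \in sp & (p z).1.2 x].
have cP : closed P.
  apply: closedI => //; apply: closed_seq_bigcup => z _.
  by apply: open_closedC; have [] := Hp z.
have cN : closed N.
  apply: closedI => //; apply: open_closedC; apply: open_seq_bigcup => z _.
  by have [] := Hp z.
have cj_closed (C : set Z) : closed C -> closed (j @` C).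
  move=> cC; apply: compact_closed => //; apply: continuous_compact.
    exact: continuous_subspaceT.
  exact: subclosed_compact cZ _.
have near_f z x : (p z).1.2 x -> `|f (j x) - f (j z)| < e.
  move=> Ux; rewrite ltNge; apply/negP => B.
  have [_ _ _ _ [/(_ _ B) Vx UV _ _]] := Hp z.
  by have : set0 x by rewrite -UV.
have [|||g [cg gf g0]] := @push_off_zero Y (j @` P) (j @` N) f e nY
    (cj_closed _ cP) (cj_closed _ cN) _ e0 (cF _).
- rewrite -subset0 => y [[x [Z0x [z zs Vx]] <-] [x' [_ Nx'] /jinj xx']].
  apply: Nx'; exists z => //; rewrite xx'; apply/Z0L => //.
  by move: zs; rewrite mem_filter => /andP[].
- move=> _ [x [Z0x [z zs Vx]] <-]; move: zs; rewrite mem_filter => /andP[fz zs].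
  have /near_f : (p z).1.2 x by apply/Z0L.
  by rewrite ltr_norml => /andP[+ _]; move: fz; lra.
- move=> _ [x [Z0x Nx] <-]; have [z zs Ux] := sZ x I.
  have fz : f (j z) < 0.
    rewrite ltNge; apply/negP => fz; apply: Nx; exists z => //.
    by rewrite mem_filter fz.
  by have /near_f := Ux; rewrite ltr_norml => /andP[_]; move: fz; lra.
exists (fun i => if unlift ord_max i is Some k then G' k else g); split.
- by move=> i; case: unliftP => [k _|_].
- by move=> i y; case: unliftP => [k ->|->] //.
- move=> _ [x _ <-]; have [Z0x|Z0x] := pselect (Z0 x); last first.
    move/asboolPn : Z0x => /existsp_asboolPn[k /eqP Gk].
    by exists (lift ord_max k); rewrite liftK.
  exists ord_max; rewrite unlift_none; apply: g0.
  have [Px|Px] := pselect (P x); first by left; exists x.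
  right; exists x => //; split => // -[z zs Ux]; apply: Px; split => //.
  exists z => //; apply/Z0L => //.
  by move: zs; rewrite mem_filter => /andP[].
Qed.
End Unstable.

Lemma card_le_ord_inj (T : Type) (A : set T) n (h : 'I_n.+1 -> T) :
  injective h -> (forall k, A (h k)) -> ~ (A #<= `I_n)%card.
Proof.
move=> hinj hA /pcard_leP[f].
have fn k : (f (h k) < n)%N by have := @funS _ _ _ _ f (h k) (hA k).
have /leq_card : injective (fun k => Ordinal (fn k)).
  by move=> k l /(congr1 val) /= /inj E; apply/hinj/E; rewrite inE; exact: hA.
by rewrite !card_ord ltnn.
Qed.

Section LowerBounds.
Variable R : realType.

Lemma positive_lower_bound n (d : 'I_n -> R) : (forall i, 0 < d i) ->
  exists2 e, 0 < e & forall i, e <= d i.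
Proof.
move=> d0; exists (\big[Num.min/1]_i d i).
  by elim/big_ind : _ => // x y x0 y0; rewrite lt_min x0.
by move=> i; rewrite (bigD1 i) //= ge_min lexx.
Qed.

Variables (n N : nat) (Y : topologicalType).
Hypothesis cY : compact [set: Y].
Hypothesis hY : hausdorff_space Y.

(** If [dim Y < n], take a finite open cover [D] of order at most [n] on whose
    members [F] oscillates little, and functions [f i] carried by the members,
    such that at each point one of them is 1.  For [n] disjoint intervals
    between levels [a k < b k] in (0,1), let [C k S] be the set of points where
    exactly the [f i] with [i] in [S] are at least [b k], and the others are at
    most [a k].  For fixed [k] these closed sets are disjoint, and small if
    [S] is nonempty: the zeros of the [k]-th coordinate on them can be removed.
    They cover [Y], as at each point one [f i] is above all intervals and at
    most [n - 1] others are nonzero, so that some interval contains no value. *)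
Lemma covering_dim_unstable (g : 'I_N -> Y -> R) :
  (forall i, continuous (g i)) -> (forall y z, (forall i, g i y = g i z) -> y = z) ->
  covering_dim_lt n Y -> zero_unstable R n [set: Y].
Proof.
move=> cg ginj dimY F e e0 cF.
have nY := compact_normal hY cY.
have e2 : 0 < e / 2 by rewrite divr_gt0.
have /choice[d_ Hd] i : exists d, 0 < d /\
    forall y z, coord_close g d y z -> `|F i y - F i z| < e / 2.
  by have [d d0 Fd] := coord_unif_continuous cY cg ginj (@cF i) e2; exists d.
have [d d0 dd] := @positive_lower_bound n d_ (fun i => (Hd i).1).
have Fd i y z : coord_close g d y z -> `|F i y - F i z| < e / 2.
  by move=> yz; apply: (Hd i).2 => k; apply: lt_le_trans (yz k) (dd i).
have oball y : open [set z | coord_close g d y z] by exact: open_coord_close.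
have [y _|y _|s _ sY] := @compact_subcover Y Y setT
    (fun y => [set z | coord_close g d y z]) setT cY.
- exact: oball.
- by exists y => // i; rewrite subrr normr0.
have [|_ [y _ <-]||D [finD oD DT DC ordD]] := 
    dimY [set [set z | coord_close g d y z] | y in [set` s]].
- exact/finite_image/finite_seq.
- exact: oball.
- rewrite -subTset => z _; have [y ys yz] := sY z I.
  by exists [set z | coord_close g d y z] => //; exists y.
have osc V y z i : D V -> V y -> V z -> `|F i y - F i z| < e.
  move=> /DC[_ [x _ <-] VU] /VU /(Fd i) xy /VU /(Fd i) xz.
  rewrite -(subrKA (F i x)) (le_lt_trans (ler_normD _ _)) //.
  by rewrite [ltRHS]splitr ltrD // distrC.
have [r r0 rD] := coord_lebesgue cY cg ginj oD DT.
pose dist y z := \sum_i `|g i y - g i z|.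
have /choice[phi Hphi] (V : set Y) : exists phi : Y -> R, D V ->
    [/\ continuous phi, forall y, phi y != 0 -> V y &
      forall y, (forall z, coord_close g r y z -> V z) -> phi y = 1].
  have [DV|nDV] := pselect (D V); last by exists (fun=> 0).
  pose W := \bigcap_(z in ~` V) [set y | r <= dist y z].
  have cW : closed W.
    apply: closed_bigI => z _; apply: closed_leR; first by move=> x; exact: cvg_cst.
    by apply: continuous_fsum => i; apply: continuous_dist => // x; exact: cvg_cst.
  have cV : closed (~` V) by apply: open_closedC; exact: oD.
  have [||f [cf f0 f1 _]] := @urysohn_ext_itv _ R nY (~` V) W 0 1 cV cW.
  - rewrite -subset0 => y [Vy /(_ y Vy)] /=; rewrite leNgt /dist.
    by rewrite big1 ?r0 // => i _; rewrite subrr normr0.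
  - exact: ltr01.
  exists f => _; split => // y.
    by apply: contraNP => Vy; apply/eqP; apply: f0; exists y.
  move=> yV; apply: f1; exists y => // z Vz /=; rewrite leNgt; apply/negP => yz.
  apply: Vz; apply: yV => i; apply: le_lt_trans yz.
  by rewrite /dist (bigD1 i) //= lerDl sumr_ge0.
have /finite_seqP[t0 Dt0] := finD; pose t := undup t0.
have Dt : D = [set` t] by rewrite Dt0; apply/seteqP; split => V /=; rewrite mem_undup.
pose m := size t; pose V_ (i : 'I_m) := nth set0 t i.
have DV i : D (V_ i) by rewrite Dt /=; exact: mem_nth.
have V_inj : injective V_.
  by move=> i j /eqP; rewrite nth_uniq ?undup_uniq // => /eqP/val_inj.
pose f i := phi (V_ i).
have cf i : continuous (f i) by have [] := Hphi _ (DV i).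
have f_supp i y : f i y != 0 -> V_ i y by have [_ + _] := Hphi _ (DV i); apply.
have f_one y : exists i, f i y = 1.
  have [V DV' Vy] := rD y; have := DV'; rewrite Dt /= => tV.
  have it : (index V t < m)%N by rewrite index_mem.
  exists (Ordinal it); rewrite /f /V_ /= nth_index //.
  by have [_ _] := Hphi _ DV'; apply.
(* The open intervals (a k, b k) are disjoint subintervals of (0, 1). *)
pose a (k : 'I_n) : R := k.*2.+1%:R / n.*2.+2%:R.
pose b (k : 'I_n) : R := k.*2.+2%:R / n.*2.+2%:R.
have ab k : a k < b k by rewrite ltr_pM2r ?invr_gt0 // ltr_nat.
have a0 k : 0 < a k by rewrite divr_gt0.
have b1 k : b k < 1.
  by rewrite ltr_pdivrMr // mul1r ltr_nat !ltnS ltn_double.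
have gaps k l x : a k < x < b k -> a l < x < b l -> k = l.
  move=> /andP[ak bk] /andP[al bl]; apply/val_inj/eqP; rewrite eqn_leq.
  have := lt_trans ak bl; have := lt_trans al bk.
  rewrite !ltr_pM2r ?invr_gt0 // !ltr_nat !ltnS !leq_double => -> ->.
  by [].
pose C k (S : {set 'I_m}) := [set y | forall i, if i \in S then b k <= f i y else f i y <= a k].
have cC k S : closed (C k S).
  by apply: closed_forall => i; case: (i \in S);
    apply: closed_leR => // x; exact: cvg_cst.
have C_inj k S S' y : C k S y -> C k S' y -> S = S'.
  move=> Cy Cy'; apply/setP => i; have := Cy i; have := Cy' i.
  have := ab k; case: (i \in S); case: (i \in S') => //; lra.
have C_cover y : exists k, exists2 S, S != finset.set0 & C k S y.
  have [i0 fi0] := f_one y.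
  have [[k Hk]|H] := pselect (exists k, forall i, ~ a k < f i y < b k).
    exists k, [set i | b k <= f i y]%SET.
      by apply/set0Pn; exists i0; rewrite inE fi0 ltW.
    move=> i; rewrite inE; case: ifPn => //; rewrite -ltNge => fb.
    by rewrite leNgt; apply/negP => af; apply: (Hk i); rewrite af.
  have /choice[tau Htau] k : exists i, a k < f i y < b k.
    by apply: contrapT => Hk; apply: H; exists k => i Hi; apply: Hk; exists i.
  (* Otherwise every interval contains a value, which with [f i0 y = 1] makes
     [n.+1] members of [D] that contain [y]. *)
  exfalso; apply: (@card_le_ord_inj _ [set V | D V /\ V y] n
    (fun k => if unlift ord_max k is Some k' then V_ (tau k') else V_ i0)) (ordD y).
    have tau0 k : V_ (tau k) <> V_ i0.
      move=> /V_inj E; have /andP[_] := Htau k; rewrite E fi0.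
      by have := b1 k; lra.
    move=> k l; case: unliftP => [k' ->|->]; case: unliftP => [l' ->|->] //.
    - by move=> /V_inj E; congr lift; apply: (gaps _ _ (f (tau k') y)); rewrite ?Htau // E.
    - by move=> /tau0.
    - by move/esym => /tau0.
  move=> k; case: unliftP => [k' _|_]; split => //; apply: f_supp.
    by have /andP[+ _] := Htau k'; have := a0 k'; move=> ? ?; rewrite gt_eqF //; lra.
  by rewrite fi0 oner_eq0.
pose good k S := S != finset.set0 /\ forall y, C k S y -> - e < F k y.
pose bad k S := S != finset.set0 /\ ~ forall y, C k S y -> - e < F k y.
pose U k (Q : {set 'I_m} -> Prop) :=
  [set y | exists2 S, S \in [seq S <- enum {set 'I_m} | `[< Q S >]] & C k S y].
have UP k Q y : U k Q y <-> exists2 S, Q S & C k S y.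
  split=> -[S]; first by rewrite mem_filter => /andP[/asboolP QS _] ?; exists S.
  by move=> QS CS; exists S => //; rewrite mem_filter mem_enum andbT; apply/asboolP.
have cU k Q : closed (U k Q) by apply: closed_seq_bigcup => S _.
have /choice[G HG] k : exists G : Y -> R, [/\ continuous G, forall y, `|G y - F k y| <= e &
    forall y, U k (good k) y \/ U k (bad k) y -> G y != 0].
  apply: push_off_zero => //.
  - rewrite -subset0 => y [/UP[S [_ gS] CS] /UP[S' [_ bS] CS']].
    by apply: bS; rewrite -(C_inj _ _ _ _ CS CS').
  - by move=> y /UP[S [_ gS] /gS].
  - move=> y /UP[S [/set0Pn[i iS] bS] CS].
    have /existsNP[z /not_implyP[Cz /negP]] := bS; rewrite -leNgt => Fz.
    have Vi x : C k S x -> V_ i x.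
      move=> /(_ i); rewrite iS => bx; apply: f_supp; rewrite gt_eqF //.
      by apply: lt_le_trans bx; have := a0 k; have := ab k; lra.
    have := osc _ _ _ k (DV i) (Vi _ CS) (Vi _ Cz); rewrite ltr_norml => /andP[_].
    by move: Fz e0; lra.
exists G; split => [k|k y|y _]; [by have [] := HG k|by have [] := HG k|].
have [k [S S0 CS]] := C_cover y; exists k; have [_ _ ->] // := HG k.
by have [gS|bS] := pselect (forall y, C k S y -> - e < F k y); [left|right]; apply/UP; exists S.
Qed.

(** Were 0 unstable on [Y], some map [G] without zeros would be so close to
    [g - 1/2] that its coordinates would have the signs required by Kuhn's
    lemma on the faces of the cube; a fine grid would then contain a small cube
    on which every coordinate of [G] changes sign, where [G] is almost 0. *)
Lemma cube_stable (g : 'I_n -> Y -> R) :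
  (forall i, continuous (g i)) -> (forall y z, (forall i, g i y = g i z) -> y = z) ->
  (forall q : 'I_n -> R, (forall i, 0 <= q i <= 1) -> exists y, forall i, g i y = q i) ->
  ~ zero_unstable R n [set: Y].
Proof.
move=> cg ginj gsurj uY.
have [||G [cG GF G0]] := uY (fun i y => g i y - 1 / 2) (1 / 4).
- by rewrite divr_gt0.
- by move=> i y; apply: cvgB; [exact: cg|exact: cvg_cst].
have [||dl dl0 Gdl] := @compact_lower_bound R _ setT (fun y => \sum_i `|G i y|) cY.
- by apply: continuous_fsum => i y; apply: cvg_norm; exact: cG.
- move=> y /G0[i Gi]; rewrite (bigD1 i) //= ltr_pwDl ?normr_gt0 //.
  exact: sumr_ge0.
pose dn := dl / n.+1%:R; have dn0 : 0 < dn by rewrite divr_gt0.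
have /choice[d_ Hd] i : exists d, 0 < d /\
    forall y z, coord_close g d y z -> `|G i y - G i z| < dn.
  by have [d d0 Fd] := coord_unif_continuous cY cg ginj (@cG i) dn0; exists d.
have [d d0 dd] := @positive_lower_bound n d_ (fun i => (Hd i).1).
have Fd i y z : coord_close g d y z -> `|G i y - G i z| < dn.
  by move=> yz; apply: (Hd i).2 => k; apply: lt_le_trans (yz k) (dd i).
pose p := (Num.truncn d^-1).+1.
have pd : p%:R^-1 < d.
  by rewrite -[d]invrK ltf_pV2 ?posrE ?invr_gt0 // truncnS_gt.
have p0 : 0 < p%:R :> R by rewrite ltr0n.
have /choice[pt Hpt] (x : 'I_n -> nat) : exists y, forall i, g i y = (minn (x i) p)%:R / p%:R.
  apply: gsurj => i; rewrite divr_ge0 //= ler_pdivrMr // mul1r ler_nat.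
  exact: geq_minr.
have Gbd i x c : g i (pt x) = c -> c - 3 / 4 <= G i (pt x) <= c - 1 / 4.
  by move=> <-; have := GF i (pt x); rewrite ler_norml => /andP[]; lra.
have [m x xm|m x xm|x xp Hx] := @kuhn n p (fun i x => 0 < G i (pt x)).
- have /Gbd/andP[_] : g m (pt x) = 0 by rewrite Hpt xm min0n mul0r.
  by move=> G1; apply/negbTE; rewrite -leNgt; lra.
- have /Gbd/andP[G1 _] : g m (pt x) = 1 by rewrite Hpt xm minnn divff // gt_eqF.
  by lra.
have := Gdl (pt x) I; apply/negP; rewrite -ltNge; apply: sum_norm_lt => // i.
rewrite -/dn; have close T : `|G i (pt (corner T x)) - G i (pt x)| < dn.
  apply: Fd => k; rewrite !Hpt -mulrBl normrM [X in _ * X]ger0_norm ?invr_ge0 ?ler0n //.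
  apply: le_lt_trans pd; rewrite ler_piMl ?invr_ge0 ?ler0n // /corner.
  have xk := xp k; rewrite (minn_idPl (ltnW xk)) (minn_idPl _); last first.
    by case: (k \in T); rewrite ?addn1 ?addn0 // ltnW.
  rewrite natrD addrAC subrr add0r normr_nat lern1.
  by case: (k \in T).
clearbody dn; have [T [T' [GT]]] := Hx i; rewrite -leNgt => GT'.
have := close T; have := close T'; rewrite !ltr_norml => /andP[? ?] /andP[? ?].
by apply/andP; split; lra.
Qed.
End LowerBounds.

(** * Upper bounds for the dimensions *)

Lemma large_small_ind n (Y : topologicalType) :
  hausdorff_space Y -> large_ind_lt n Y -> small_ind_lt n Y.
Proof.
elim: n Y => [//|n IH] Y hY indY y B cB By.
have [||L LP indL] := indY [set y] B _ cB.
- exact/accessible_closed_set1/hausdorff_accessible.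
- by rewrite -subset0 => z [->].
exists L => //; apply: IH => //; exact: set_type_hausdorff.
Qed.

Section UpperBounds.
Variable R : realType.

Lemma avoid_seq (s : seq R) (d : R) : 0 < d -> exists r, [/\ 0 < r, r < d & r \notin s].
Proof.
move=> d0; pose m := \big[Num.min/d]_(x <- s | 0 < x) x.
have m0 : 0 < m by rewrite /m; elim/big_ind : _ => // x y x0 y0; rewrite lt_min x0.
have md : m <= d.
  by rewrite /m; elim/big_rec : _ => // x y _ yd; rewrite ge_min yd orbT.
have ms x : x \in s -> 0 < x -> m <= x.
  rewrite /m; elim: s {m m0 md} => [//|z s IH]; rewrite inE big_cons => /orP[/eqP <- ->|xs x0].
    by rewrite ge_min lexx.
  by case: ifP => _; rewrite ?ge_min IH ?orbT.
exists (m / 2); split; [by rewrite divr_gt0|by lra|].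
by apply/negP => /ms; rewrite divr_gt0 // => /(_ isT); lra.
Qed.

(** The induction that bounds [Ind] concerns spaces each point of which has
    less than [n] coordinates outside a finite set [E] of levels.  Cover
    [A] by finitely many open boxes with centres in [A], whose faces lie at
    levels outside [E] and whose closures miss [B]; the union of the closed
    boxes minus that of the open ones is a partition, and at each of its points
    one of the coordinates is such a level. *)
Lemma large_ind_free n N (Y : topologicalType) (g : 'I_N -> Y -> R) (E : seq R) :
  compact [set: Y] -> (forall i, continuous (g i)) ->
  (forall y z, (forall i, g i y = g i z) -> y = z) ->
  (forall y, (#|[set i | g i y \notin E]%SET| < n)%N) -> large_ind_lt n Y.
Proof.
elim: n Y g E => [|n IH] Y g E cY cg ginj gE.
  by apply/seteqP; split => // y; have := gE y; rewrite ltn0.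
move=> A B cA cB AB.
have /choice[r Hr] a : exists r, A a -> [/\ 0 < r,
    forall z, (forall i, `|g i a - g i z| <= r) -> ~ B z,
    forall i, g i a + r \notin E & forall i, g i a - r \notin E].
  have [Aa|] := pselect (A a); last by exists 0.
  have [|d d0 dB] := @coord_nbhs R N Y g cY cg ginj a (~` B).
    apply: open_nbhs_nbhs; split; first exact: closed_openC.
    by move=> Ba; have : set0 a by rewrite -AB.
  (* The radius is chosen so that the levels of the faces are not in [E]. *)
  have [r [r0 rd rE]] := avoid_seq ([seq e - g i a | i <- enum 'I_N, e <- E] ++
    [seq g i a - e | i <- enum 'I_N, e <- E]) d0.
  exists r => _; split => // [z az|i|i].
  - by apply: dB => i; apply: le_lt_trans (az i) rd.
  - apply: contra rE => H; rewrite mem_cat; apply/orP; left.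
    by apply/allpairsP; exists (i, g i a + r); rewrite mem_enum /= addrAC subrr add0r.
  - apply: contra rE => H; rewrite mem_cat; apply/orP; right.
    by apply/allpairsP; exists (i, g i a - r); rewrite mem_enum /= opprB addrCA subrr addr0.
pose O a := [set z | forall i, `|g i a - g i z| < r a].
pose K a := [set z | forall i, `|g i a - g i z| <= r a].
have oO a : open (O a) by exact: open_coord_close.
have cK a : closed (K a).
  apply: closed_forall => i; apply: closed_leR; last by move=> x; exact: cvg_cst.
  by apply: continuous_dist => // x; exact: cvg_cst.
have OK a : O a `<=` K a by move=> z az i; exact: ltW.
have [||a Aa|s sA As] := @compact_subcover Y Y A O A.
- exact: subclosed_compact cY _.
- by move=> a _; exact: oO.
- by exists a => // i; rewrite subrr normr0; have [] := Hr a Aa.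
pose U := [set y | exists2 a, a \in s & O a y].
pose W := [set y | exists2 a, a \in s & K a y].
have oU : open U by exact: open_seq_bigcup.
have cW : closed W by exact: closed_seq_bigcup.
have cL : closed (W `&` ~` U) by apply: closedI => //; exact: open_closedC.
exists (W `&` ~` U).
  split=> //; exists U, (~` W); split => //; first exact: closed_openC.
  - by move=> y By [a /sA Aa Kay]; have [_ /(_ y Kay)] := Hr a Aa.
  - split; last by rewrite setCI setCK setUC.
    by rewrite -subset0 => y [[a sa Oa]]; apply; exists a => //; apply: OK.
pose E' := E ++ [seq g i a + r a | i <- enum 'I_N, a <- s]
             ++ [seq g i a - r a | i <- enum 'I_N, a <- s].
apply: (IH _ (fun i (x : set_type (W `&` ~` U)) => g i (\val x)) E').
- by apply: set_type_compact; apply: subclosed_compact cY _.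
- by move=> i; apply: continuous_comp_fun (cg i); exact: continuous_val.
- by move=> x y xy; apply/val_inj/ginj.
move=> [y yL] /=; have [[a sa Ka] Uy] := set_mem yL.
have [i Oi] : exists i, ~ `|g i a - g i y| < r a.
  by apply/existsNP => H; apply: Uy; exists a.
have ri : `|g i a - g i y| = r a.
  by apply/le_anti; rewrite Ka /= leNgt; apply/negP.
have [_ _ rp rm] := Hr a (sA a sa).
rewrite -ltnS; apply: leq_trans (gE y); rewrite ltnS; apply: proper_card.
apply/properP; split.
  by apply/fintype.subsetP => k; rewrite !inE mem_cat negb_or => /andP[].
have [gm|gp] : g i y = g i a - r a \/ g i y = g i a + r a.
- have [h|h] := leP 0 (g i a - g i y).
    by left; move: ri; rewrite ger0_norm //; lra.
  by right; move: ri; rewrite ltr0_norm //; lra.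
- exists i; rewrite !inE gm // negbK !mem_cat; apply/orP; right; apply/orP; right.
  by apply/allpairsP; exists (i, a); rewrite mem_enum.
- exists i; rewrite !inE gp // negbK !mem_cat; apply/orP; right; apply/orP; left.
  by apply/allpairsP; exists (i, a); rewrite mem_enum.
Qed.

(** For each [j <= n], the cubes [V (j, z)] of side [d] of the grid translated
    by [j / n.+1] are disjoint.  A coordinate of a point lies on the walls of at
    most one of these [n.+1] grids, so that the point is inside a cube of at
    least one of them. *)
Lemma covering_dim_coord n (Y : topologicalType) (g : 'I_n -> Y -> R) :
  compact [set: Y] -> (forall i, continuous (g i)) ->
  (forall y z, (forall i, g i y = g i z) -> y = z) -> covering_dim_lt n.+1 Y.
Proof.
move=> cY cg ginj C finC oC CT.
have [d d0 dC] := coord_lebesgue cY cg ginj oC CT.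
pose t (j : 'I_n.+1) i y : R := g i y / d - j%:R / n.+1%:R.
pose V (p : 'I_n.+1 * {ffun 'I_n -> int}) :=
  [set y | forall i, (p.2 i)%:~R < t p.1 i y < (p.2 i + 1)%:~R].
have ct j i : continuous (t j i).
  move=> y; apply: cvgB; last exact: cvg_cst.
  by apply: cvgM; [exact: cg|exact: cvg_cst].
have oV p : open (V p).
  have -> : V p = ~` [set y | exists2 i, i \in enum 'I_n &
      ([set y | t p.1 i y <= (p.2 i)%:~R] `|` [set y | (p.2 i + 1)%:~R <= t p.1 i y]) y].
    apply/seteqP; split => y.
      by move=> Vy [i _] /= []; have /andP[h1 h2] := Vy i; rewrite leNgt ?h1 ?h2.
    move=> H i; apply/andP; rewrite !ltNge.
    by split; apply/negP => Hi; apply: H; exists i; rewrite ?mem_enum //; [left|right].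
  apply: closed_openC; apply: closed_seq_bigcup => i _; apply: closedU.
    by apply: closed_leR => // x; exact: cvg_cst.
  by apply: closed_leR => // x; exact: cvg_cst.
have Vfloor j z y : V (j, z) y -> z = [ffun i => Num.floor (t j i y)].
  move=> Vy; apply/ffunP => i; rewrite ffunE; apply/esym/floor_def.
  by have /andP[/ltW -> ->] := Vy i.
have [p _|y _|s _ sY] := @compact_subcover Y _ setT V setT cY.
- exact: oV.
- have [j Hj] : exists j, forall i, t j i y != (Num.floor (t j i y))%:~R.
    apply: contrapT => H.
    have /choice[tau Htau] (j : 'I_n.+1) : exists i, t j i y = (Num.floor (t j i y))%:~R.
      apply: contrapT => Hj; apply: H; exists j => i; apply/eqP => Hi; apply: Hj; by exists i.
    have /injectivePn[j [j' jj' tt]] : ~~ injectiveb tau.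
      apply/negP => /injectiveP/leq_card; by rewrite !card_ord ltnn.
    have := Htau j; have := Htau j'; rewrite -tt.
    move: (Num.floor _) (Num.floor _) => a b; rewrite /t => Ha Hb.
    have : (j%:Z - j'%:Z)%:~R = ((b - a) * n.+1%:Z)%:~R :> R.
      rewrite intrM !intrB -Ha -Hb -!pmulrn.
      have n0 : n.+1%:R != 0 :> R by rewrite pnatr_eq0.
      have E (u v w : R) : u - v - (u - w) = w - v by ring.
      by rewrite E mulrBl !divfK.
    move=> /intr_inj; move: jj'; rewrite -val_eqE /=.
    have := ltn_ord j; have := ltn_ord j'.
    move: (nat_of_ord j) (nat_of_ord j') => k k' /=.
    have [->|] := eqVneq a b; first by lia.
    by nia.
  exists (j, [ffun i => Num.floor (t j i y)]) => // i /=; rewrite ffunE.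
  have /andP[fl ->] := floor_itv (t j i y).
  by rewrite lt_def fl Hj.
exists (V @` [set p | p \in s /\ V p !=set0]); split.
- by apply: finite_image; apply: (sub_finite_set (B := [set` s])) => // p [].
- by move=> _ [p _ <-]; exact: oV.
- rewrite -subTset => y _; have [p ps Vy] := sY y I.
  by exists (V p) => //; exists p => //; split => //; exists y.
- move=> _ [[j z] [_ [y Vy]] <-]; have [U CU yU] := dC y; exists U => // x Vx.
  apply: yU => i; have /andP[x1 x2] := Vx i; have /andP[y1 y2] := Vy i.
  have : `|t j i y - t j i x| < 1.
    by move: x1 x2 y1 y2; rewrite /= !intrD => *; rewrite ltr_norml; apply/andP; split; lra.
  rewrite /t opprB addrA subrK -mulrBl normrM (gtr0_norm (x := d^-1)) ?invr_gt0 //.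
  by rewrite ltr_pdivrMr // mul1r.
- move=> y; pose h k := V (inord k, [ffun i => Num.floor (t (inord k) i y)]).
  apply: card_le_trans (card_image_le h `I_n.+1).
  apply: subset_card_le => _ [[[j z] [_ _] <-] Vy].
  by exists (nat_of_ord j); [exact: ltn_ord|rewrite /h inord_val -(Vfloor _ _ _ Vy)].
Qed.

(** A compact space embedded in R^n with an image that contains the cube has
    dimension [n], for the three dimension functions. *)
Theorem coord_dimension n (Y : topologicalType) (g : 'I_n -> Y -> R) :
  compact [set: Y] -> hausdorff_space Y -> (forall i, continuous (g i)) ->
  (forall y z, (forall i, g i y = g i z) -> y = z) ->
  (forall q : 'I_n -> R, (forall i, 0 <= q i <= 1) -> exists y, forall i, g i y = q i) ->
  [/\ covering_dim_eq Y n, small_ind_eq Y n & large_ind_eq Y n].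
Proof.
move=> cY hY cg ginj gsurj; have st := cube_stable cY cg ginj gsurj.
have large : large_ind_lt n.+1 Y.
  apply: (@large_ind_free _ _ Y g [::]) => // y.
  by rewrite ltnS (leq_trans (max_card _)) // card_ord.
have nsmall : ~ small_ind_lt n Y.
  move=> /(@small_ind_unstable R n Y Y id cY cY hY) H; apply: st.
  have -> : [set: Y] = range id by rewrite image_id.
  by apply: H => // x; exact: cvg_id.
split; split.
- exact: covering_dim_coord cY cg ginj.
- by move=> /(covering_dim_unstable cY hY cg ginj).
- exact: large_small_ind.
- exact: nsmall.
- exact: large.
- by move=> /(large_small_ind hY).
Qed.
End UpperBounds.

(** * Compactifications defined by functions *)

Lemma continuous_to_prod (T : topologicalType) (I : Type) (K : I -> topologicalType)
    (f : T -> prod_topology K) :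
  (forall i, continuous (fun x => f x i)) -> continuous f.
Proof.
move=> cf x; apply/cvg_sup => i; move: x.
apply/(@continuousP _ (initial_topology (@^~ i))) => A [B oB <-].
rewrite -comp_preimage; apply: open_comp => // y _; exact: cf.
Qed.

Lemma continuous_to_set_type (S T : topologicalType) (A : set T) (f : S -> set_type A) :
  continuous (fun x => \val (f x)) -> continuous f.
Proof.
move=> cf; apply/continuousP => _ [V oV <-].
by rewrite -comp_preimage; apply: open_comp => // y _; exact: cf.
Qed.

Section EvalCompactification.
Variables (R : realType) (X : topologicalType) (F : eval_family R X) (hX : hausdorff_space X).
Local Notation K := (eval_compactification F hX).

(** The extension to the compactification of a function of the family, that is
    a coordinate of the product of intervals. *)
Definition eval_ext (f : set_type (family_set F)) (z : K) : R := \val (\val z f).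

Lemma eval_ext_continuous f : continuous (eval_ext f).
Proof.
rewrite /eval_ext.
apply: (@continuous_comp_fun _ _ _ (fun z : K => \val z f) (fun y => \val y)).
  apply: (@continuous_comp_fun _ _ _ (fun z : K => \val z) (proj f)).
    exact: continuous_val.
  exact: proj_continuous.
exact: continuous_val.
Qed.

Lemma eval_ext_emb f x : eval_ext f (cemb K x) = \val f x.
Proof. by []. Qed.

Lemma eval_ext_inj p q : (forall f, eval_ext f p = eval_ext f q) -> p = q.
Proof.
by move=> pq; apply: val_inj; apply: functional_extensionality_dep => f; apply: val_inj; exact: pq.
Qed.

(** The compactification associated with [F] lies below [t] as soon as the
    functions of [F] extend continuously to [t]. *)
Lemma cle_eval (t : compactification X) :
  (forall f, family_set F f -> 
    exists2 ft : t -> R, continuous ft & forall x, ft (cemb t x) = f x) ->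
  cle K t.
Proof.
move=> ext.
have /choice[ft Hft] (f : set_type (family_set F)) :
    exists ft : t -> R, continuous ft /\ forall x, ft (cemb t x) = \val f x.
  by have [ft] := ext _ (set_mem (valP f)); exists ft.
have ftitv f p : ft f p \in range_itv (\val f).
  have [cf fE] := Hft f; rewrite inE.
  apply: (dense_closed (@cemb_dense X t) (C := ft f @^-1` range_itv (\val f))).
    by apply: preimage_closed => [y _|]; [exact: cf|exact: interval_closed].
  move=> _ [x _ <-]; rewrite /= fE; apply/set_mem/mem_range_itv.
  exact/family_bounded/set_mem/valP.
pose G (p : t) : eval_cube F := fun f => exist _ (ft f p) (ftitv f p).
have cG : continuous G.
  apply: continuous_to_prod => f; apply: continuous_to_set_type.
  exact: (Hft f).1.
have GE x : G (cemb t x) = @eval_map R X F x.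
  apply: functional_extensionality_dep => f; apply: val_inj => /=.
  exact: (Hft f).2.
have Gcl p : G p \in closure (range (@eval_map R X F)).
  rewrite inE; apply: (dense_closed (@cemb_dense X t)
    (C := G @^-1` closure (range (@eval_map R X F)))).
    by apply: preimage_closed => [y _|]; [exact: cG|exact: closed_closure].
  by move=> _ [x _ <-] /=; rewrite GE; apply: subset_closure; exists x.
exists (fun p => exist _ (G p) (Gcl p)); first exact: continuous_to_set_type.
by move=> x; apply: val_inj => /=; exact: GE.
Qed.

End EvalCompactification.

(** * The metric defined by a sequence of functions *)

Section SupMetric.
Variables (R : realType) (X : topologicalType) (psi : nat -> X -> R).
Hypothesis cpsi : forall k, continuous (psi k).
Hypothesis psi_bd : forall k x, `|psi k x| <= k.+1%:R^-1.
Hypothesis psi_sep : forall x y, (forall k, psi k x = psi k y) -> x = y.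
Hypothesis psi_gen : forall x (U : set X), nbhs x U -> exists k, exists2 e, 0 < e &
  forall y, `|psi k x - psi k y| < e -> U y.

(** The distance of [X] as embedded by [psi] in the Hilbert cube, with the supremum norm. *)
Definition sup_dist x y : R := sup (range (fun k => `|psi k x - psi k y|)).

Lemma psi_dist_le k x y : `|psi k x - psi k y| <= 2 / k.+1%:R.
Proof.
rewrite (le_trans (ler_normB _ _)) // mulr2n mulrDl mul1r.
by rewrite lerD.
Qed.

Lemma le_sup_dist k x y : `|psi k x - psi k y| <= sup_dist x y.
Proof.
apply: ub_le_sup; last by exists k.
exists 2 => _ [l _ <-]; rewrite (le_trans (psi_dist_le l x y)) //.
by rewrite ler_pdivrMr ?ltr0n // ler_peMr // ler1n.
Qed.

Lemma sup_dist_le x y c : (forall k, `|psi k x - psi k y| <= c) -> sup_dist x y <= c.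
Proof. by move=> xy; apply: ge_sup => [|_ [k _ <-]//]; exists `|psi 0 x - psi 0 y|, 0%N. Qed.

(** Up to [e], the distance only depends on finitely many of the functions. *)
Lemma sup_dist_small e : 0 < e -> exists N, forall x y,
  (forall k, (k < N)%N -> `|psi k x - psi k y| <= e) -> sup_dist x y <= e.
Proof.
move=> e0; exists (Num.truncn (2 / e)) => x y xy; apply: sup_dist_le => k.
have [/xy//|Nk] := ltnP k (Num.truncn (2 / e)).
apply: le_trans (psi_dist_le k x y) _; rewrite ler_pdivrMr ?ltr0n //.
rewrite mulrC -ler_pdivrMr // ltW // (lt_le_trans (truncnS_gt _)) // ler_nat.
by rewrite ltnS.
Qed.

Lemma sup_dist_nbhs x e : 0 < e -> nbhs x [set y | sup_dist x y < e].
Proof.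
move=> e0; have e2 : 0 < e / 2 by rewrite divr_gt0.
have [N HN] := sup_dist_small e2.
have : nbhs x [set y | forall k : 'I_N, `|psi k x - psi k y| < e / 2].
  apply: filter_forall => k.
  by have /continuousRP := @cpsi k; apply.
apply: filterS => y xy; apply: (@le_lt_trans _ _ (e / 2)); last by lra.
by apply: HN => k kN; exact: ltW (xy (Ordinal kN)).
Qed.

Definition sup_metric : compatible_metric R X.
Proof.
apply: (@CompatibleMetric R X sup_dist).
- move=> x; apply/le_anti; rewrite sup_dist_le => [|k]; last by rewrite subrr normr0.
  exact: le_trans (le_sup_dist 0 x x).
- move=> x y xy; apply: psi_sep => k; apply/eqP; rewrite -subr_eq0 -normr_le0 -xy.
  exact: le_sup_dist.
- by move=> x y; congr sup; apply: eq_imagel => k _; rewrite distrC.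
- move=> x y z; apply: sup_dist_le => k.
  rewrite -(subrKA (psi k y)) (le_trans (ler_normD _ _)) //.
  by rewrite lerD // le_sup_dist.
- move=> x U; split=> [/psi_gen[k [e e0 xU]]|[e e0 xU]].
    by exists e => // y /= xy; apply: xU; apply: le_lt_trans xy; exact: le_sup_dist.
  by apply: filterS xU _; exact: sup_dist_nbhs.
Defined.

Lemma sup_metricE x y : sup_metric x y = sup_dist x y.
Proof. by []. Qed.

Lemma sup_metric_totally_bounded : totally_bounded sup_metric.
Proof.
move=> e e0; have [[x0 _]|X0] := pselect ([set: X] !=set0); last first.
  by exists set0 => // x; case: X0; exists x.
have e2 : 0 < e / 2 by rewrite divr_gt0.
have [N HN] := sup_dist_small e2.
pose M := Num.truncn (2 / (e / 2)).
pose tr k x := Num.truncn ((psi k x + 1) / (e / 2)).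
have psi1 k x : -1 <= psi k x <= 1.
  rewrite -ler_norml (le_trans (psi_bd k x)) // invf_le1 ?ltr0n // ler1n //.
have tr_itv k x : (tr k x)%:R <= (psi k x + 1) / (e / 2) < (tr k x).+1%:R.
  apply: truncn_itv; rewrite divr_ge0 ?(ltW e2) //.
  by have /andP[+ _] := psi1 k x; lra.
have trM k x : (tr k x < M.+1)%N.
  rewrite ltnS truncn_le_nat; apply: le_lt_trans (truncnS_gt _).
  by rewrite ler_pM2r ?invr_gt0 //; have /andP[_] := psi1 k x; lra.
pose cell x : {ffun 'I_N -> 'I_M.+1} := [ffun k : 'I_N => Ordinal (trM k x)].
have /choice[rep Hrep] c : exists x, (exists y, cell y = c) -> cell x = c.
  have [[y <-]|H] := pselect (exists y, cell y = c); first by exists y.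
  by exists x0.
exists [set` [seq rep c | c <- enum {ffun 'I_N -> 'I_M.+1}]]; first exact: finite_seq.
move=> x; exists (rep (cell x)); first by apply: map_f; rewrite mem_enum.
have E : cell (rep (cell x)) = cell x.
  by apply: Hrep; exists x.
rewrite sup_metricE; apply: (@le_lt_trans _ _ (e / 2)); last by lra.
apply: HN => k kN; rewrite ler_norml; move/ffunP/(_ (Ordinal kN)) : E.
rewrite !ffunE /= => /(congr1 val) /= E.
have /andP[] := tr_itv k x; have /andP[] := tr_itv k (rep (cell x)).
rewrite E -[(tr k x).+1%:R]natr1 !ler_pdivlMr // !ltr_pdivrMr // => a1 a2 a3 a4.
by apply/andP; split; move: a1 a2 a3 a4; lra.
Qed.

Lemma Ustar_psi f c : 0 < c -> (exists k, forall x, f x = c * psi k x) -> Ustar sup_metric f.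
Proof.
move=> c0 [k fE]; split; last first.
  by exists (c * k.+1%:R^-1) => x; rewrite fE normrM gtr0_norm // ler_pM2l.
move=> e e0; exists (e / c); first by rewrite divr_gt0.
move=> x y xy; rewrite !fE -mulrBr normrM gtr0_norm // mulrC -ltr_pdivlMr //.
exact: le_lt_trans (le_sup_dist k x y) xy.
Qed.
End SupMetric.

(** * The remainder of a Smirnov compactification *)

Lemma compact_seq_bigcup (T : topologicalType) (I : choiceType) (s : seq I) (C : I -> set T) :
  (forall i, compact (C i)) -> compact [set x | exists2 i, i \in s & C i x].
Proof.
move=> cC; suff -> : [set x | exists2 i, i \in s & C i x] = \big[setU/set0]_(i <- s) C i.
  exact: bigsetU_compact.
by rewrite -bigcup_seq; apply/seteqP; split => x [i]; exists i.
Qed.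

(** A sequence of compactly supported functions whose cozero sets form a base
    of the topology. *)
Record bump_base (R : realType) (X : topologicalType) := BumpBase {
  bump_fun : nat -> X -> R ;
  bump_supp : nat -> set X ;
  bump_continuous : forall k, continuous (bump_fun k) ;
  bump_le1 : forall k x, `|bump_fun k x| <= 1 ;
  bump_supp_compact : forall k, compact (bump_supp k) ;
  bump_supp_sub : forall k x, bump_fun k x != 0 -> bump_supp k x ;
  bump_nbhs : forall (x : X) (U : set X), nbhs x U ->
    exists2 k, bump_fun k x != 0 & forall y, bump_fun k y != 0 -> U y }.

(** The remainder of the Smirnov compactification for the metric defined by the
    functions [g i] and the bumps; [gsurj] says that outside every compact set
    the values of [g] are dense in the cube. *)
Section Remainder.
Variables (R : realType) (X : topologicalType) (n : nat).
Hypothesis hX : hausdorff_space X.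
Variables (b : bump_base R X) (g : 'I_n -> X -> R) (B : R).
Hypothesis B0 : 0 < B.
Hypothesis cg : forall i, continuous (g i).
Hypothesis gB : forall i x, `|g i x| <= B.
Hypothesis gsurj : forall (q : 'I_n -> R) (e : R) (K : set X),
  (forall i, 0 <= q i <= 1) -> 0 < e -> compact K ->
  exists2 x, ~ K x & forall i, `|g i x - q i| < e.

(** First the coordinates of [g], then the bumps, scaled so as to be bounded by
    [k.+1%:R^-1]. *)
Definition coord_seq k x : R :=
  (if insub k is Some i then g i x / B else bump_fun b (k - n) x) / k.+1%:R.

Lemma coord_seq_g (i : 'I_n) x : coord_seq i x = g i x / B / i.+1%:R.
Proof. by rewrite /coord_seq valK. Qed.

Lemma coord_seq_bump k x : coord_seq (n + k) x = bump_fun b k x / (n + k).+1%:R.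
Proof. by rewrite /coord_seq insubF ?addKn // ltnNge leq_addr. Qed.

Lemma coord_seq_continuous k : continuous (coord_seq k).
Proof.
move=> x; apply: cvgM; last exact: cvg_cst.
case: insubP => [i _ _|_]; last exact: bump_continuous.
by apply: cvgM; [exact: cg|exact: cvg_cst].
Qed.

Lemma coord_seq_bd k x : `|coord_seq k x| <= k.+1%:R^-1.
Proof.
rewrite normrM [X in _ * X]gtr0_norm ?invr_gt0 // ler_piMl ?invr_ge0 //.
case: insubP => [i _ _|_]; last exact: bump_le1.
by rewrite normrM [X in _ * X]gtr0_norm ?invr_gt0 // ler_pdivrMr // mul1r.
Qed.

Lemma coord_seq_gen x (U : set X) : nbhs x U -> exists k, exists2 e, 0 < e &
  forall y, `|coord_seq k x - coord_seq k y| < e -> U y.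
Proof.
move=> /(bump_nbhs b)[k kx kU]; exists (n + k)%N, `|coord_seq (n + k) x|.
  by rewrite normr_gt0 coord_seq_bump mulf_neq0 // invr_neq0.
move=> y xy; apply: kU; apply: contraTN xy => /eqP ky.
by rewrite [coord_seq _ y]coord_seq_bump ky mul0r subr0 ltxx.
Qed.

Lemma coord_seq_sep x y : (forall k, coord_seq k x = coord_seq k y) -> x = y.
Proof.
move=> xy; apply: contrapT => nxy.
have [|k [e e0 H]] := @coord_seq_gen x (~` [set y]).
  apply: open_nbhs_nbhs; split => //; apply: closed_openC.
  exact/accessible_closed_set1/hausdorff_accessible.
by apply: (H y) => //; rewrite xy subrr normr0.
Qed.

Let rho := sup_metric coord_seq_continuous coord_seq_bd coord_seq_sep coord_seq_gen.
Let K := smirnov rho.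

Let rho_g i : Ustar rho (g i).
Proof.
apply: (@Ustar_psi _ _ _ _ _ _ _ (g i) (B * i.+1%:R)); first by rewrite mulr_gt0.
exists i => x; rewrite coord_seq_g -mulrA -invfM mulrC divfK //.
by rewrite mulf_neq0 // gt_eqF.
Qed.

Let rho_bump k : Ustar rho (bump_fun b k).
Proof.
apply: (@Ustar_psi _ _ _ _ _ _ _ (bump_fun b k) (n + k).+1%:R) => //.
by exists (n + k)%N => x; rewrite coord_seq_bump mulrC divfK.
Qed.

(** The extension to [K] of a bounded uniformly continuous function. *)
Let ext (f : X -> R) (Uf : Ustar rho f) : K -> R :=
  @eval_ext R X (Ustar_family rho) (cmetric_hausdorff rho) (exist _ f (mem_set Uf)).

Let ext_continuous f Uf : continuous (@ext f Uf).
Proof. exact: eval_ext_continuous. Qed.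

Let ext_emb f Uf x : @ext f Uf (cemb K x) = f x.
Proof. exact: eval_ext_emb. Qed.

Let ext_bump k := ext (rho_bump k).
Let ext_g i := ext (rho_g i).

Let ext_bump_continuous k : continuous (ext_bump k).
Proof. exact: (@ext_continuous _ (rho_bump k)). Qed.

Let ext_g_continuous i : continuous (ext_g i).
Proof. exact: (@ext_continuous _ (rho_g i)). Qed.

(** A bump is carried by a compact subset of [X], so its extension vanishes on
    the remainder. *)
Let range_bump k p : ext_bump k p != 0 -> range (cemb K) p.
Proof.
move=> kp; apply: contrapT => np.
have cC : closed (cemb K @` bump_supp b k).
  apply: compact_closed; first exact: cspace_hausdorff.
  apply: continuous_compact; last exact: bump_supp_compact.
  by apply: continuous_subspaceT; exact: cemb_continuous.
have [||z [[kq nq] [x _ xq]]] := @cemb_dense X K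
    ([set z | ext_bump k z != 0] `&` ~` (cemb K @` bump_supp b k)).
- by exists p; split => // -[x _ xp]; apply: np; exists x.
- by apply: openI; [exact/open_neq0/ext_bump_continuous|exact: closed_openC].
apply: nq; rewrite -xq; exists x => //; apply: bump_supp_sub.
by move: kq; rewrite -xq.
Qed.

Let remainder_bump p k : ~ range (cemb K) p -> ext_bump k p = 0.
Proof. by move=> np; apply/eqP; apply: contrapT => /negP /range_bump. Qed.

Let range_bumpP p : range (cemb K) p -> exists k, ext_bump k p != 0.
Proof.
by move=> [x _ <-]; have [k kx _] := bump_nbhs b (@filterT _ (nbhs x) _); exists k.
Qed.

Let remainder_closed : closed (~` range (cemb K)).
Proof.
have -> : ~` range (cemb K) = [set p | forall k, (~` [set p | ext_bump k p != 0]) p].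
  apply/seteqP; split => p.
    by move=> np k /=; rewrite remainder_bump // eqxx.
  by move=> pk /range_bumpP[k kp]; exact: (pk k).
by apply: closed_forall => k; exact/open_closedC/open_neq0/ext_bump_continuous.
Qed.

(** A uniformly continuous [f] does not separate [p] and [q]: points of [X] near
    [p] and points of [X] near [q] have close coordinates in [g], and
    almost-zero bumps, hence are close for [rho]. *)
Let remainder_inj p q : ~ range (cemb K) p -> ~ range (cemb K) q ->
  (forall i, ext_g i p = ext_g i q) -> p = q.
Proof.
move=> np nq pq; apply: eval_ext_inj => -[f Uf'].
have Uf := set_mem Uf'; rewrite (Prop_irrelevance Uf' (mem_set Uf)).
rewrite -/(ext Uf); apply/eqP; rewrite -subr_eq0 -normr_le0 leNgt; apply/negP => pq0.
pose e := `|ext Uf p - ext Uf q| / 3; have e0 : 0 < e by rewrite divr_gt0.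
have [d d0 fd] := Uf.1 e e0.
have d2 : 0 < d / 2 by rewrite divr_gt0.
have [N HN] := sup_dist_small coord_seq_bd d2.
have Ucs k : Ustar rho (coord_seq k).
  by apply: (@Ustar_psi _ _ _ _ _ _ _ _ 1) => //; exists k => x; rewrite mul1r.
have cs_pq k : ext (Ucs k) p = ext (Ucs k) q.
  have [kn|nk] := ltnP k n.
    have E z : ext (Ucs k) z = ext_g (Ordinal kn) z / B / k.+1%:R.
      move: z; apply: (continuous_dense_eq (@cemb_dense X K)).
      - exact: ext_continuous.
      - by apply: continuous_mulr; apply: continuous_mulr; exact: ext_g_continuous.
      - by move=> _ [x _ <-]; rewrite /ext_g !ext_emb (coord_seq_g (Ordinal kn)).
    by rewrite !E pq.
  have E z : ext (Ucs k) z = ext_bump (k - n) z / k.+1%:R.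
    move: z; apply: (continuous_dense_eq (@cemb_dense X K)).
    - exact: ext_continuous.
    - by apply: continuous_mulr; exact: ext_bump_continuous.
    - move=> _ [x _ <-]; rewrite /ext_bump !ext_emb.
      by rewrite -{1}(subnKC nk) coord_seq_bump subnKC.
  by rewrite !E !remainder_bump.
pose O r := [set z : K | forall k : 'I_N, `|ext (Ucs k) r - ext (Ucs k) z| < d / 4] `&`
  [set z | `|ext Uf r - ext Uf z| < e].
have d4 : 0 < d / 4 by rewrite divr_gt0.
have oO r : open (O r).
  apply: openI.
    exact: (@open_coord_close R N K (fun k => ext (Ucs k)) (d / 4) r).
  apply: open_ltR; last exact: cst_continuous.
  by apply: continuous_dist; [exact: cst_continuous|exact: ext_continuous].
have Or r : O r r by split=> [k|] /=; rewrite subrr normr0.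
have [||z1 [[px pfx] [x _ xE]]] := @cemb_dense X K (O p); [by exists p|exact: oO|].
have [||z2 [[qy qfy] [y _ yE]]] := @cemb_dense X K (O q); [by exists q|exact: oO|].
subst; rewrite /= ext_emb in pfx; rewrite /= ext_emb in qfy.
have xy : rho x y < d.
  apply: (@le_lt_trans _ _ (d / 2)); last by lra.
  apply: HN => k kN; have := px (Ordinal kN); have := qy (Ordinal kN).
  rewrite /= !ext_emb cs_pq !ltr_norml ler_norml => /andP[? ?] /andP[? ?].
  by apply/andP; split; lra.
have := fd x y xy; have : `|ext Uf p - ext Uf q| = 3 * e by rewrite /e; lra.
move: pfx qfy; rewrite !ltr_norml => /andP[p1 p2] /andP[q1 q2] pqE /andP[f1 f2].
have : `|ext Uf p - ext Uf q| < 3 * e by rewrite ltr_norml; apply/andP; split; lra.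
by rewrite pqE ltxx.
Qed.

(** Otherwise the extension of [g] stays away from [q] on the remainder, and the
    points where it is close to [q] form a compact subset of [X], against
    [gsurj]. *)
Let remainder_surj q : (forall i, 0 <= q i <= 1) ->
  exists2 p, ~ range (cemb K) p & forall i, ext_g i p = q i.
Proof.
move=> q01; apply: contrapT => H.
have cm : compact (~` range (cemb K)).
  exact: subclosed_compact remainder_closed (@cspace_compact X K) _.
have [||d d0 Hd] := @compact_lower_bound R K (~` range (cemb K))
    (fun p => \sum_i `|ext_g i p - q i|) cm.
- apply: continuous_fsum => i; apply: continuous_dist; last exact: cst_continuous.
  exact: ext_g_continuous.
- move=> p np; rewrite lt_def sumr_ge0 ?andbT => [|i _//].
  apply/eqP => m0; apply: H; exists p => // i; apply/eqP.
  rewrite -subr_eq0 -normr_le0 -m0 (bigD1 i) //= lerDl.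
  by apply: sumr_ge0.
have dn0 : 0 < d / n.+1%:R by rewrite divr_gt0.
pose e := d / n.+1%:R / 2; have e0 : 0 < e by rewrite divr_gt0.
pose Z := [set p | forall i, `|ext_g i p - q i| <= e].
have cZ : closed Z.
  apply: closed_forall => i; apply: closed_leR; last exact: cst_continuous.
  by apply: continuous_dist; [exact: ext_g_continuous|exact: cst_continuous].
have Zr p : Z p -> range (cemb K) p.
  move=> Zp; apply: contrapT => /Hd; apply/negP; rewrite -ltNge.
  apply: sum_norm_lt => // i; apply: le_lt_trans (Zp i) _.
  by rewrite /e ltr_pdivrMr // ltr_pMr // ltr1n.
have [||p Zp|s _ sZ] := @compact_subcover K nat setT 
    (fun k => [set p | ext_bump k p != 0]) Z.
- exact: subclosed_compact cZ (@cspace_compact X K) _.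
- by move=> k _; exact/open_neq0/ext_bump_continuous.
- by have [k kp] := range_bumpP (Zr p Zp); exists k.
have [x nx xq] := gsurj q01 e0 (compact_seq_bigcup (s := s) (@bump_supp_compact _ _ b)).
have [|k ks] := sZ (cemb K x).
  by move=> i; rewrite /ext_g ext_emb ltW.
rewrite /= /ext_bump ext_emb => kx.
by apply: nx; exists k => //; exact: bump_supp_sub.
Qed.

Lemma remainder_dimension : exists rho0 : compatible_metric R X,
  [/\ totally_bounded rho0, forall i, Ustar rho0 (g i) &
      [/\ covering_dim_eq (remainder (smirnov rho0)) n,
          small_ind_eq (remainder (smirnov rho0)) n &
          large_ind_eq (remainder (smirnov rho0)) n]].
Proof.
exists rho; split; [exact: sup_metric_totally_bounded|exact: rho_g|].
apply: (@coord_dimension R n _ (fun i (y : remainder K) => ext_g i (\val y))).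
- apply: set_type_compact.
  exact: subclosed_compact remainder_closed (@cspace_compact X K) _.
- exact: set_type_hausdorff (@cspace_hausdorff X K).
- move=> i; apply: continuous_comp_fun (@ext_continuous _ _); exact: continuous_val.
- move=> [y ny] [z nz] /= yz; apply: val_inj; apply: remainder_inj => //=.
    exact: set_mem ny.
  exact: set_mem nz.
- move=> q /remainder_surj[p np pq].
  by exists (exist _ p (mem_set np)).
Qed.
End Remainder.

(** * Bumps and interpolation on locally compact separable metric spaces *)

Section MetricSpace.
Variables (R : realType) (X : topologicalType) (rho : compatible_metric R X).

Lemma cmetric_continuous a : continuous (rho a).
Proof.
apply/continuousRP => x e e0; apply/(cmetric_nbhs rho); exists e => // y /= xy.
have h1 := cmetric_triangle rho a x y; have h2 := cmetric_triangle rho a y x.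
rewrite (cmetric_sym rho y x) in h2.
by rewrite ltr_norml; apply/andP; split; lra.
Qed.

Lemma cmetric_normal : normal_space X.
Proof.
apply/(@normal_openP R).
have oball (A : set X) (r : X -> R) :
    open [set z | exists2 a, A a & rho a z < r a / 2].
  have -> : [set z | exists2 a, A a & rho a z < r a / 2] =
      \bigcup_(a in A) [set z | rho a z < r a / 2].
    by apply/seteqP; split => z [a Aa az]; exists a.
  apply: bigcup_open => a _; apply: open_ltR; last exact: cst_continuous.
  exact: cmetric_continuous.
have rad (A B : set X) : closed B -> A `&` B = set0 ->
    exists r : X -> R, forall a, A a -> 0 < r a /\ forall z, B z -> r a <= rho a z.
  move=> cB AB.
  suff /choice[r Hr] a : exists ra, A a -> 0 < ra /\ forall z, B z -> ra <= rho a z by exists r.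
  have [Aa|] := pselect (A a); last by exists 0.
  have : nbhs a (~` B).
    apply: open_nbhs_nbhs; split; first exact: closed_openC.
    by move=> Ba; have : set0 a by rewrite -AB.
  move=> /(cmetric_nbhs rho)[e e0 eB]; exists e => _; split => // z Bz.
  by rewrite leNgt; apply/negP => /eB.
move=> A B cA cB AB.
have [r Hr] := rad A B cB AB.
have [s Hs] : exists r : X -> R, forall a, B a -> 0 < r a /\ forall z, A z -> r a <= rho a z.
  by apply: rad => //; rewrite setIC.
exists [set z | exists2 a, A a & rho a z < r a / 2], [set z | exists2 a, B a & rho a z < s a / 2].
split; [exact: oball|exact: oball| | |].
- by move=> a Aa; exists a => //; rewrite cmetric_refl divr_gt0 //; case: (Hr a Aa).
- by move=> a Aa; exists a => //; rewrite cmetric_refl divr_gt0 //; case: (Hs a Aa).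
rewrite -subset0 => z [[a Aa az] [c Bc cz]].
have [_ /(_ c Bc)] := Hr a Aa; have [_ /(_ a Aa)] := Hs c Bc.
have := cmetric_triangle rho a z c; rewrite (cmetric_sym rho c a) (cmetric_sym rho z c).
by lra.
Qed.

(** The bumps are the hats [max 0 (r - rho d y)], with [d] in a countable dense
    set and [r] the inverse of a positive integer, for which the closed ball of
    centre [d] and radius [r] is compact. *)
Lemma exists_bump_base : separable_space X -> locally_compact [set: X] ->
  inhabited (bump_base R X).
Proof.
move=> [D cD dD] lcX.
have /pcard_leP[f] : (D #<= [set: nat])%card by [].
have finj := @inj _ _ _ f.
pose rad m : R := m.+1%:R^-1.
have rad0 m : 0 < rad m by rewrite invr_gt0.
pose cball d m := [set y | rho d y <= rad m].
pose hat d m y := Num.max 0 (rad m - rho d y).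
have chat d m : continuous (hat d m).
  move=> y; apply: (@continuous_max R X (cst 0) (fun z => rad m - rho d z) y).
    exact: cst_continuous.
  by apply: cvgB; [exact: cvg_cst|exact: cmetric_continuous].
have hat_neq0 d m y : (hat d m y != 0) = (rho d y < rad m).
  rewrite /hat /Num.max subr_gt0; case: ifPn => [yr|_]; last by rewrite eqxx.
  by rewrite subr_eq0 gt_eqF.
have /choice[p Hp] (k : nat) : exists p : (X -> R) * set X,
    [/\ continuous p.1, forall x, `|p.1 x| <= 1, compact p.2,
        forall x, p.1 x != 0 -> p.2 x &
        forall d m, D d -> k = pickle (f d, m) -> compact (cball d m) -> p.1 = hat d m].
  have [[d [m [Dd kE cB]]]|H] := pselect (exists d m,
      [/\ D d, k = pickle (f d, m) & compact (cball d m)]).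
    exists (hat d m, cball d m); split => //=.
    - move=> x; rewrite ger0_norm /hat ?le_max ?lexx // ge_max ler01 /=.
      rewrite lerBlDr (le_trans (_ : _ <= 1)) //.
        by rewrite invf_le1 ?ltr0n // ler1n.
      by rewrite lerDl cmetric_ge0.
    - by move=> x; rewrite hat_neq0 => /ltW.
    - move=> d' m' Dd'; rewrite kE => /(pcan_inj pickleK)[/finj dd ->] _.
      by rewrite dd // inE.
  exists (fun=> 0, set0); split => //=.
  - exact: cst_continuous.
  - by move=> x; rewrite normr0.
  - exact: compact0.
  - by move=> x; rewrite eqxx.
  - by move=> d m Dd kE cB; case: H; exists d, m.
constructor; apply: (@BumpBase R X (fun k => (p k).1) (fun k => (p k).2)).
- by move=> k; have [] := Hp k.
- by move=> k; have [] := Hp k.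
- by move=> k; have [] := Hp k.
- by move=> k; have [] := Hp k.
move=> x U xU.
have [N xN [cN _]] : exists2 N, nbhs x N & compact N /\ closed N.
  have [N NN [cN clN]] := lcX x I.
  by rewrite withinET in NN; exists N.
have [e e0 eUN] : exists2 e : R, 0 < e & [set y | rho x y < e] `<=` U `&` N.
  by apply/(cmetric_nbhs rho)/filterI.
pose m := Num.truncn (2 / e).
have me : 2 * rad m < e.
  rewrite /rad ltr_pdivrMr ?ltr0n // mulrC -ltr_pdivrMr //; exact: truncnS_gt.
have [||d [xd Dd]] := dD [set y | rho x y < rad m].
- by exists x; rewrite /= cmetric_refl.
- by apply: open_ltR; [exact: cmetric_continuous|exact: cst_continuous].
have near_x y : rho d y <= rad m -> rho x y < e.
  move=> dy; apply: le_lt_trans (cmetric_triangle rho x d y) _.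
  by move: xd => /=; lra.
have cB : compact (cball d m).
  apply: subclosed_compact cN _; last by move=> y /near_x /eUN[].
  by apply: closed_leR; [exact: cmetric_continuous|exact: cst_continuous].
exists (pickle (f d, m)); have [_ _ _ _ /(_ d m Dd erefl cB) ->] := Hp (pickle (f d, m)).
  by rewrite hat_neq0 (cmetric_sym rho).
by move=> y; rewrite hat_neq0 => /ltW /near_x /eUN[].
Qed.
End MetricSpace.

Section Interpolation.
Variables (R : realType) (X : topologicalType).

(** The sequence [e] tends to infinity in [X]. *)
Definition leaves_compacts (e : nat -> X) := forall K : set X, compact K ->
  exists N, forall k, (N <= k)%N -> ~ K (e k).

(** Every bounded sequence of reals is the restriction to [e] of a bounded
    continuous function. *)
Definition interpolates (e : nat -> X) := forall (c : nat -> R) (M : R), 0 < M ->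
  (forall k, `|c k| <= M) -> exists h : X -> R,
    [/\ continuous h, forall x, `|h x| <= M & forall k, h (e k) = c k].

Lemma exists_escaping_seq (b : bump_base R X) : ~ compact [set: X] ->
  exists e : nat -> X, injective e /\ leaves_compacts e.
Proof.
move=> ncX.
pose K N := [set x | exists2 k, k \in iota 0 N & bump_supp b k x].
pose A N := [set x | exists2 k, (k < N)%N & bump_fun b k x != 0].
have AK N : A N `<=` K N.
  by move=> x [k kN kx]; exists k; [rewrite mem_iota|exact: bump_supp_sub].
have cK N : compact (K N) by apply: compact_seq_bigcup; exact: bump_supp_compact.
have A_mono N N' : (N <= N')%N -> A N `<=` A N'.
  by move=> NN x [k kN kx]; exists k => //; exact: leq_trans NN.
have /choice[pick Hpick] N : exists x, ~ K N x.
  apply: contrapT => H; apply: ncX; suff -> : [set: X] = K N by [].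
  by apply/seteqP; split => // x _; apply: contrapT => Kx; apply: H; exists x.
have /choice[lev Hlev] x : exists N, A N x.
  by have [k kx _] := bump_nbhs b (@filterT _ (nbhs x) _); exists k.+1, k.
(* [pick (idx m)] lies outside [K (idx m)] and inside [A (idx m.+1)]. *)
pose idx := fix idx m := if m is m'.+1 then maxn (idx m').+1 (lev (pick (idx m'))) else 0%N.
have idx_mono m m' : (m <= m')%N -> (idx m <= idx m')%N.
  move=> /subnK <-; elim: (m' - m)%N => [//|l IH]; apply: leq_trans IH _.
  by rewrite addSn /= leq_max leqnSn.
have idx_ge m : (m <= idx m)%N.
  by elim: m => [//|m IH]; rewrite /= leq_max ltnS IH.
have e_in m m' : (m < m')%N -> A (idx m') (pick (idx m)).
  move=> /idx_mono mm; apply: (A_mono _ _ (leq_trans _ mm) _ (Hlev _)).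
  by rewrite /= leq_max leqnn orbT.
exists (fun m => pick (idx m)); split.
  have neq m m' : (m < m')%N -> pick (idx m) <> pick (idx m').
    by move=> /e_in /AK + E; rewrite E; exact: Hpick.
  move=> m m'; case: (ltngtP m m') => [/neq//|/neq mm E|//].
  by case: mm.
move=> C cC.
have [k _|x _|s _ sC] := @compact_subcover X nat setT 
    (fun k => [set x | bump_fun b k x != 0]) C cC.
- exact/open_neq0/bump_continuous.
- by have [k kx _] := bump_nbhs b (@filterT _ (nbhs x) _); exists k.
exists (\max_(k <- s) k).+1 => m sm Cm.
have [k ks kx] := sC _ Cm.
apply: (Hpick (idx m)); apply: AK; exists k => //.
apply: leq_ltn_trans (leq_trans sm (idx_ge m)); exact: leq_bigmax_seq.
Qed.

(** The range of a sequence that leaves every compact set is closed and discrete,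
    so that Tietze's theorem applies. *)
Lemma escaping_interpolates (b : bump_base R X) (e : nat -> X) :
  hausdorff_space X -> normal_space X ->
  injective e -> leaves_compacts e -> interpolates e.
Proof.
move=> hX nX einj eK c M M0 cM.
have loc x (S : set X) : S `<=` range e -> nbhs x (~` (S `\ x)).
  move=> Se.
  have [k kx _] := bump_nbhs b (@filterT _ (nbhs x) _).
  have [N HN] := eK _ (@bump_supp_compact _ _ b k).
  pose F := [set e m | m in `I_N] `\ x.
  have cF : closed F.
    apply: (accessible_finite_set_closed.1 (hausdorff_accessible hX)).
    by apply: finite_setD; apply: finite_image; exact: finite_II.
  have : nbhs x ([set y | bump_fun b k y != 0] `&` ~` F).
    apply: open_nbhs_nbhs; split; last by split => // -[_]; apply.
    by apply: openI; [exact/open_neq0/bump_continuous|exact: closed_openC].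
  apply: filterS => y [/= ky Fy] [Sy yx].
  have [m _ my] := Se y Sy; apply: Fy; split => //; exists m => //=.
  rewrite ltnNge; apply/negP => /HN; apply; rewrite my; exact: bump_supp_sub.
have cR : closed (range e).
  rewrite -openC openE => x nx; rewrite /interior; have := loc x _ (@subset_refl _ (range e)).
  by apply: filterS => y yx ey; apply: yx; split => // yx; apply: nx; rewrite -yx.
have /choice[idx Hidx] x : exists k, range e x -> e k = x.
  have [[k _ <-]|H] := pselect (range e x); first by exists k.
  by exists 0%N.
pose f x := c (idx x).
have fe k : f (e k) = c k by rewrite /f; congr c; apply: einj; apply: Hidx; exists k.
have cf : {within range e, continuous f}.
  apply/subspace_continuousP => x ex W /nbhs_singleton Wx.
  have := loc x _ (@subset_refl _ (range e)); rewrite /within /= => H.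
  apply: filterS H => y yx ey; have -> // : y = x.
  by apply: contrapT => nyx; apply: yx.
have [|h [hf ch hM]] := continuous_bounded_extension nX cR M0 cf.
  by move=> _ [k _ <-]; rewrite fe.
by exists h; split => // k; rewrite -hf ?fe // inE; exists k.
Qed.
End Interpolation.

(** A sequence of points of the cube, each tail of which is dense in the cube. *)
Definition recurrently_dense (R : realType) n (q : nat -> 'I_n -> R) :=
  (forall k i, 0 <= q k i <= 1) /\
  forall (p : 'I_n -> R) (e : R) (N : nat), (forall i, 0 <= p i <= 1) -> 0 < e ->
    exists2 k, (N <= k)%N & forall i, `|q k i - p i| < e.

(** With [v] an enumeration of a dense set, the sequence of the [v (logn 2 k)]
    takes each value infinitely often. *)
Lemma exists_recurrently_dense (R : realType) n :
  exists q : nat -> 'I_n -> R, recurrently_dense q.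
Proof.
pose clamp (x : R) := Num.max 0 (Num.min x 1).
pose v k i := if unpickle k is Some w then clamp (ratr ((w : {ffun 'I_n -> rat}) i)) else 0.
exists (fun k => v (logn 2 k)); split=> [k i|p e N p01 e0].
  rewrite /v; case: unpickle => [w|]; last by rewrite lexx ler01.
  by rewrite le_max lexx /= ge_max ler01 ge_min lexx orbT.
have /choice[w Hw] i : exists r : rat, ratr r \in `]p i - e, p i + e[%R.
  by apply: rat_in_itvoo; lra.
(* The power of 3 makes the index large without changing its 2-valuation. *)
pose k := (2 ^ pickle (finfun w) * 3 ^ N)%N; exists k.
  apply: leq_trans (ltnW (ltn_expl N (isT : 1 < 3)%N)) _.
  by rewrite leq_pmull // expn_gt0.
move=> i; have -> : logn 2 k = pickle (finfun w).
  by rewrite lognM ?expn_gt0 // pfactorK // lognX (logn_coprime (m := 3)) // muln0 addn0.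
rewrite /v pickleK ffunE; have := Hw i; have /andP[p0 p1] := p01 i.
rewrite in_itv /= => /andP[w1 w2]; rewrite ltr_norml /clamp.
apply/andP; split.
  rewrite ltrBrDl lt_max lt_min; apply/orP.
  have [h|h] := ltP (p i - e) 0; [by left|right].
  by apply/andP; split; lra.
by rewrite ltrBlDl gt_max gt_min; apply/andP; split; [lra|rewrite w2].
Qed.

(** A function that takes along [e] the values of the first coordinates of a
    recurrently dense sequence is uniformly continuous for a metric of the
    family: interpolate the other coordinates along [e]. *)
Lemma exists_good_metric (R : realType) (X : topologicalType) (b : bump_base R X) m
    (u : X -> R) (e : nat -> X) (q : nat -> 'I_m.+1 -> R) :
  hausdorff_space X -> continuous u -> bounded_real u ->
  leaves_compacts e -> interpolates R e -> recurrently_dense q ->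
  (forall k, u (e k) = q k ord0) ->
  exists rho : compatible_metric R X,
  [/\ totally_bounded rho, Ustar rho u &
      [/\ covering_dim_eq (remainder (smirnov rho)) m.+1,
          small_ind_eq (remainder (smirnov rho)) m.+1 &
          large_ind_eq (remainder (smirnov rho)) m.+1]].
Proof.
move=> hX cu [M uM] eK eI [q01 qd] uq.
have /choice[h Hh] i : exists h : X -> R,
    [/\ continuous h, forall x, `|h x| <= 1 & forall k, h (e k) = q k i].
  apply: eI => // k; have /andP[? ?] := q01 k i; by rewrite ger0_norm.
pose g i := if i == ord0 then u else h i.
have ge k i : g i (e k) = q k i.
  by rewrite /g; case: eqP => [->//|_]; have [_ _] := Hh i.
have cg i : continuous (g i).
  by rewrite /g; case: eqP => // _; have [] := Hh i.
have B0 : 0 < Num.max M 1 by rewrite lt_max ltr01 orbT.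
have gB i x : `|g i x| <= Num.max M 1.
  rewrite le_max /g; case: eqP => _; first by rewrite uM.
  by have [_ -> _] := Hh i; rewrite orbT.
have [|rho [tb Ug dims]] := @remainder_dimension R X m.+1 hX b g _ B0 cg gB.
  move=> p d K p01 d0 /eK[N eN]; have [k Nk qk] := qd p d N p01 d0.
  by exists (e k) => [|i]; [exact: eN|rewrite ge].
by exists rho; split => //; have := Ug ord0; rewrite /g eqxx.
Qed.

Lemma interpolates_sub (R : realType) (X : topologicalType) (e : nat -> X) (s : nat -> nat) :
  injective s -> interpolates R e -> interpolates R (e \o s).
Proof.
move=> sinj eI c M M0 cM.
have /choice[t Ht] j : exists k, (exists k', s k' = j) -> s k = j.
  have [[k <-]|H] := pselect (exists k, s k = j); first by exists k.
  by exists 0%N.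
have [|h [ch hM he]] := eI (fun j => c (t j)) M M0; first by [].
exists h; split => // k; rewrite /= he; congr c.
by apply: sinj; apply: Ht; exists k.
Qed.

Lemma leaves_compacts_sub (X : topologicalType) (e : nat -> X) (s : nat -> nat) :
  (forall k, (k <= s k)%N) -> leaves_compacts e -> leaves_compacts (e \o s).
Proof.
move=> sk eK K /eK[N HN]; exists N => k Nk; apply: HN; exact: leq_trans (sk k).
Qed.

Theorem proposition3p3 (R : realType) (X : topologicalType)
    (hmet : metrizable R X) (hsep : separable_space X)
    (hlc : locally_compact [set: X]) (hnc : ~ compact [set: X])
    (n : nat) (hn : (0 < n)%N) :
  exists2 s : compactification X,
    is_csup
      (fun K => exists rho : compatible_metric R X,
         [/\ K = smirnov rho,
             covering_dim_eq (remainder (smirnov rho)) n,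
             small_ind_eq (remainder (smirnov rho)) n,
             large_ind_eq (remainder (smirnov rho)) n &
             totally_bounded rho]) s &
    cequiv (stone_cech R (metrizable_tychonoff hmet)) s.
Proof.
exists (stone_cech R (metrizable_tychonoff hmet)); last first.
  by exists id, id; split => // x; exact: cvg_id.
split.
  move=> _ [rho [-> _ _ _ _]]; apply: cle_eval => f Uf.
  have Cf : family_set (Cstar_family R (metrizable_tychonoff hmet)) f.
    by split; [exact: Ustar_continuous Uf|exact: Uf.2].
  exists (@eval_ext _ _ _ (metrizable_tychonoff hmet).1 (exist _ f (mem_set Cf))) => //.
  exact: eval_ext_continuous.
move=> t Ht; apply: cle_eval => f [cf [M fM]].
case: hmet => rho0; have hX := cmetric_hausdorff rho0.
have [b] := exists_bump_base rho0 hsep hlc.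
case: n hn Ht => [//|m] _ Ht.
have extends (u : X -> R) (e : nat -> X) (q : nat -> 'I_m.+1 -> R) :
    continuous u -> bounded_real u -> leaves_compacts e -> interpolates R e ->
    recurrently_dense q -> (forall k, u (e k) = q k ord0) ->
    exists2 ut : t -> R, continuous ut & forall x, ut (cemb t x) = u x.
  move=> cu bu eK eI qd ue.
  have [rho [tb Uu [d1 d2 d3]]] := exists_good_metric b hX cu bu eK eI qd ue.
  have [|j cj jE] := Ht (smirnov rho); first by exists rho.
  exists (fun p => @eval_ext _ _ (Ustar_family rho) (cmetric_hausdorff rho)
    (exist _ u (mem_set Uu)) (j p)).
    by apply: continuous_comp_fun cj _; exact: eval_ext_continuous.
  by move=> x; rewrite jE.
have [e [einj eK]] := exists_escaping_seq b hnc.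
have eI : interpolates R e.
  by apply: (escaping_interpolates b) => //; exact: cmetric_normal rho0.
have [q qd] := exists_recurrently_dense R m.+1.
have M0 : 0 <= M by have := fM (e 0%N); apply: le_trans.
(* The first coordinate of [q k] is the value of [h] at [e k.*2], and that of
   [f + h] at [e k.*2.+1]. *)
pose c k := q k./2 ord0 - (if odd k then f (e k) else 0).
have [||h [ch hM he]] := eI c (M + 1); first by rewrite ltr_wpDl.
  move=> k; rewrite addrC (le_trans (ler_normB _ _)) // lerD //.
    by have /andP[? ?] := qd.1 k./2 ord0; rewrite ger0_norm.
  by case: ifP => _; rewrite ?normr0.
have bh : bounded_real h by exists (M + 1).
have [ht cht htE] : exists2 ut : t -> R, continuous ut & forall x, ut (cemb t x) = h x.
  apply: (extends h (e \o double) q) => //.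
  - by apply: leaves_compacts_sub => // k; rewrite -addnn leq_addr.
  - by apply: interpolates_sub => //; exact: double_inj.
  - by move=> k; rewrite /= he /c odd_double doubleK subr0.
have [gt cgt gtE] : exists2 ut : t -> R, continuous ut & forall x, ut (cemb t x) = f x + h x.
  apply: (extends (fun x => f x + h x) (e \o (fun k => k.*2.+1)) q) => //.
  - by move=> x; apply: cvgD; [exact: cf|exact: ch].
  - exists (M + (M + 1)) => x; rewrite (le_trans (ler_normD _ _)) // lerD //.
  - by apply: leaves_compacts_sub => // k; rewrite -addnn ltnW // ltnS leq_addr.
  - by apply: interpolates_sub => // k l [] /double_inj.
  - by move=> k; rewrite /= he /c /= odd_double /= uphalf_double addrC subrK.
exists (fun p => gt p - ht p); last by move=> x; rewrite gtE htE addrK.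
by move=> p; apply: cvgB; [exact: cgt|exact: cht].
Qed.
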